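(* Let $d\ge1$ and $n\ge0$ with $d$ dividing $n$. Then the poset $\Omega_n^{(d)}$ admits a recursive atom ordering, and hence is CL-shellable and Cohen–Macaulay.
   Context: $[n]=\{1,\ldots,n\}$. An ordered set partition of $[n]$ is a sequence $(B_1,\ldots,B_k)$ of nonempty pairwise disjoint sets (blocks) with union $[n]$; it is $d$-divisible if every block has size divisible by $d$. The $d$-divisible ordered set partitions of $[n]$ are ordered by: $(B_1,\ldots,B_k)$ is covered by each $(B_1,\ldots,B_{i-1},B_i\cup B_{i+1},B_{i+2},\ldots,B_k)$, extended transitively; $\Omega_n^{(d)}$ is this poset with a unique minimum $\hat0$ adjoined; its maximum is $([n])$. For a finite bounded poset $P$ with atom set $\mathcal{A}(P)$, a linear ordering $a_1,\ldots,a_t$ of $\mathcal A(P)$ is a recursive atom ordering if (R1) for every $j$, the interval $[a_j,\hat1]$ admits a recursive atom ordering in which the atoms of $[a_j,\hat 1]$ that cover some $a_i$ with $i<j$ come first, and (R2) for all $i<k$, if $a_i,a_k<y$ for some $y$, then there exist $j<k$ and $x\in P$ with $a_j\lessdot x$, $a_k\lessdot x$ and $x\le y$ ($\lessdot$ denotes covering). *)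

(* Defs.v *)
From HB Require Import structures.
From mathcomp Require Import all_boot all_order all_algebra.

Set Implicit Arguments.
Unset Strict Implicit.
Unset Printing Implicit Defensive.

Import Order.Theory GRing.Theory.

(* 'I_n = {0, ..., n-1} plays the role of [n] = {1, ..., n}. *)
Section OrderedPartitions.
Variables d n : nat.

Definition is_ordered_partition (s : seq {set 'I_n}) : bool :=
  [&& all (fun B : {set 'I_n} => (B != set0) && (d %| #|B|)) s,
      pairwise (fun A B : {set 'I_n} => [disjoint A & B]) s
    & \bigcup_(B <- s) B == setT].

(* For n = 0 the empty sequence of blocks is the unique element. *)
Record ordered_partition := OrderedPartition {
  blocks :> seq {set 'I_n};
  blocksP : is_ordered_partition blocks }.

HB.instance Definition _ := [isSub for blocks].
HB.instance Definition _ := [Choice of ordered_partition by <:].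

Lemma size_blocks (s : ordered_partition) : size s <= n.
Proof.
have [/allP nz dis /eqP cov] := and3P (blocksP s).
suff: size s <= #|\bigcup_(B <- s) B|.
  by rewrite cov cardsT card_ord.
elim: (blocks s) nz dis {cov} => [|B t IH] //= nz /andP[/allP disB dist].
rewrite big_cons cardsU.
have /eqP -> : B :&: \bigcup_(C <- t) C == set0.
  rewrite setI_eq0; apply/pred0P => x /=; apply/andP => -[xB].
  rewrite big_tnth => /bigcupP[i _ xi].
  by have /disjointFr/(_ xB) := disB _ (mem_tnth i (in_tuple t)); rewrite xi.
rewrite cards0 subn0 -add1n leq_add //.
  by have /andP[] := nz B (mem_head _ _); rewrite card_gt0.
by apply: IH => // C Ct; apply: nz; rewrite inE Ct orbT.
Qed.

Definition bseq_of_partition (s : ordered_partition) : n.-bseq {set 'I_n} :=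
  Bseq (size_blocks s).
Definition partition_of_bseq (s : n.-bseq {set 'I_n}) :
  option ordered_partition := insub (s : seq _).

Lemma bseq_of_partitionK : pcancel bseq_of_partition partition_of_bseq.
Proof. by move=> s; rewrite /partition_of_bseq /= valK. Qed.

HB.instance Definition _ := PCanIsCountable bseq_of_partitionK.
HB.instance Definition _ : isFinite ordered_partition :=
  PCanIsFinite bseq_of_partitionK.

(* t arises from s by replacing two adjacent blocks by their union. *)
Definition merges (s t : ordered_partition) : bool :=
  [exists i : 'I_(size s), (i.+1 < size s) &&
    (blocks t == take i s ++ (nth set0 s i :|: nth set0 s i.+1) :: drop i.+2 s)].

(* None is the adjoined minimum. *)
Definition Omega : Type := option ordered_partition.

HB.instance Definition _ := Finite.on Omega.

Definition Omega_le (x y : Omega) : bool :=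
  match x, y with
  | None, _ => true
  | Some _, None => false
  | Some s, Some t => connect merges s t
  end.

Definition Omega_bot : Omega := None.

(* The one-block partition ([n]), read as the empty sequence when n = 0; if
   d does not divide n there is no partition at all and this is None. *)
Definition Omega_top : Omega :=
  insub [seq B <- [:: [set: 'I_n]] | B != set0].

Lemma merges_size s t : merges s t -> size s = (size t).+1.
Proof.
case/existsP=> i /andP[lt_i /eqP ->].
rewrite size_cat /= size_drop size_takel ?(ltnW (ltn_ord i)) //.
by rewrite addnS -addSn -addSn subnKC.
Qed.

Lemma connect_size s t : connect merges s t -> s = t \/ size t < size s.
Proof.
case/connectP=> p; elim: p s => [|u p IH] s /=; first by left.
case/andP=> /merges_size su up tl; right.
by case: (IH u up tl) => [<-|/ltnW le_tu]; rewrite su ltnS.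
Qed.

Lemma Omega_le_refl : reflexive Omega_le.
Proof. by case=> [s|] //=; apply: connect0. Qed.

Lemma Omega_le_anti : antisymmetric Omega_le.
Proof.
move=> [s|] [t|] //= /andP[/connect_size[->//|lt1] /connect_size[->//|lt2]].
by have := ltn_trans lt1 lt2; rewrite ltnn.
Qed.

Lemma Omega_le_trans : transitive Omega_le.
Proof. by move=> [s|] [t|] [u|] //=; apply: connect_trans. Qed.

Fact Omega_display : Order.disp_t. Proof. exact: Order.Disp tt tt. Qed.

HB.instance Definition _ := Order.Le_isPOrder.Build Omega_display Omega
  Omega_le_refl Omega_le_anti Omega_le_trans.

Lemma Omega_bot_le x : (Omega_bot <= x :> Omega)%O.
Proof. by []. Qed.

Lemma merge_exists (s : ordered_partition) : 1 < size s -> exists t, merges s t.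
Proof.
case: s => -[|A [|B s]] // sP _.
have tP : is_ordered_partition ((A :|: B) :: s).
  move: sP; rewrite /is_ordered_partition !big_cons /= setUA.
  case/and3P=> /and3P[/andP[A0 dA] /andP[B0 dB] ->].
  case/and3P=> /andP[disAB disA] disB -> ->; rewrite !andbT.
  apply/andP; split; first (apply/andP; split).
  - by rewrite setU_eq0 negb_and A0.
  - by rewrite cardsU (disjoint_setI0 disAB) cards0 subn0 dvdn_add.
  apply/allP=> C Cs; move/allP/(_ C Cs): disA; move/allP/(_ C Cs): disB => dB' dA'.
  by rewrite -setI_eq0 setIUl !disjoint_setI0 ?setU0.
exists (OrderedPartition tP); apply/existsP; exists ord0 => /=.
by rewrite drop0.
Qed.

Lemma Omega_le_top x : (x <= Omega_top :> Omega)%O.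
Proof.
case: x => [s|] //; rewrite /Order.le /=.
have [m] := ubnP (size s); elim: m s => // m IH s; rewrite ltnS => le_sm.
have [/merge_exists[t st]|] := ltnP 1 (size s).
  have lt_tm : size t < m by rewrite -(merges_size st).
  have := IH t lt_tm; rewrite /Omega_le; case: Omega_top => // u.
  exact: connect_trans (connect1 st).
move=> size1; suff -> : Omega_top = Some s by apply: connect0.
rewrite /Omega_top -(valK s); congr insub.
case: s size1 {le_sm} => -[|B [|? ?]] //= /and3P[/= B0 _] /eqP.
  by rewrite big_nil => <- _; rewrite eqxx.
by rewrite big_seq1 => eB _; move: B0; rewrite eB => /andP[/andP[->]].
Qed.

HB.instance Definition _ :=
  Order.hasBottom.Build Omega_display Omega Omega_bot_le.
HB.instance Definition _ :=
  Order.hasTop.Build Omega_display Omega Omega_le_top.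

End OrderedPartitions.

Section BoundedPosets.
Variables (disp : Order.disp_t) (P : finTBPOrderType disp).
Local Open Scope order_scope.

Definition covers : rel P :=
  fun x y => (x < y) && [forall z, ~~ ((x < z) && (z < y))].

(* A linear ordering s of the atoms of the interval [x, \top] is a recursive
   atom ordering of that interval. The recursion ends at x = \top, which has
   no atoms; [\bot, \top] is the whole poset. *)
Inductive recursive_atom_ordering (x : P) (s : seq P) : Prop :=
  RecursiveAtomOrdering of
    uniq s
  & (forall a, (a \in s) = covers x a)
  & (forall j, (j < size s)%N ->
       let late b := has (fun a => covers a b) (take j s) in
       exists t1 t2, [/\ recursive_atom_ordering (nth \bot s j) (t1 ++ t2),
                         all late t1 & ~~ has late t2])
  & (forall i k y, (i < k < size s)%N ->
       nth \bot s i < y -> nth \bot s k < y ->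
       exists j z, [/\ (j < k)%N, covers (nth \bot s j) z,
                       covers (nth \bot s k) z & z <= y]).

Definition admits_recursive_atom_ordering : Prop :=
  exists s, recursive_atom_ordering \bot s.

(* Maximal chains x = x_0 <. x_1 <. ... <. x_l = y of [x, y], represented by
   [:: x_1; ...; x_l]. *)
Definition maximal_chain (x y : P) (c : seq P) : bool :=
  path covers x c && (last x c == y).

Section ChainLabelings.
Variables (dispL : Order.disp_t) (L : porderType dispL).

(* lam c i is the label of the edge x_i <. x_(i+1) of the maximal chain c of P;
   chains sharing their first k edges must carry the same labels there. *)
Definition chain_edge_labeling (lam : seq P -> nat -> L) : Prop :=
  forall c c' k, maximal_chain \bot \top c -> maximal_chain \bot \top c' ->
    take k c = take k c' -> forall i, (i < k)%N -> lam c i = lam c' i.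

(* The label word of the maximal chain m of the rooted interval [x, y]_r, read
   off the maximal chain of P made of r, m and a maximal chain e of [y, \top];
   for a chain-edge labeling it does not depend on e. *)
Definition label_word (lam : seq P -> nat -> L) (r m e : seq P) : seqlexi L :=
  [seq lam (r ++ m ++ e) i | i <- iota (size r) (size m)].

Definition CL_labeling (lam : seq P -> nat -> L) : Prop :=
  chain_edge_labeling lam /\
  forall (x y : P) (r e : seq P), x < y ->
    maximal_chain \bot x r -> maximal_chain y \top e ->
    exists m, [/\ maximal_chain x y m,
      sorted <%O (label_word lam r m e : seq L),
      (forall m', maximal_chain x y m' ->
         sorted <%O (label_word lam r m' e : seq L) -> m' = m)
    & (forall m', maximal_chain x y m' -> m' <> m ->
         label_word lam r m e < label_word lam r m' e)].

End ChainLabelings.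

Definition CL_shellable : Prop :=
  exists (dispL : Order.disp_t) (L : porderType dispL) (lam : seq P -> nat -> L),
    CL_labeling lam.

Definition order_complex : {set {set P}} :=
  [set F : {set P} | [forall x in F, forall y in F, x >=< y]].

End BoundedPosets.

(* Reduced simplicial homology of a simplicial complex K on a finite vertex set
   T. Faces are oriented by the enumeration order of T, the empty face included,
   and everything is indexed by the cardinality m of the faces, that is, by
   homological degree m - 1. *)
Section SimplicialComplexes.
Variables (T : finType) (R : comNzRingType).
Implicit Types (K : {set {set T}}) (F G : {set T}) (c : {ffun {set T} -> R}).
Local Open Scope ring_scope.

Definition link K F : {set {set T}} :=
  [set G : {set T} | [disjoint F & G] && (F :|: G \in K)].

Definition simplicial_chain K (m : nat) c : Prop :=
  forall F, ~~ ((F \in K) && (#|F| == m)) -> c F = 0.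

Definition boundary c : {ffun {set T} -> R} :=
  [ffun G : {set T} => \sum_(x | x \notin G)
     (-1) ^+ #|[set y in G | (enum_rank y < enum_rank x)%N]| * c (x |: G)].

(* The reduced homology of K over R vanishes in degree m - 1. *)
Definition homology_vanishes K (m : nat) : Prop :=
  forall z, simplicial_chain K m z -> boundary z = 0 ->
  exists2 b, simplicial_chain K m.+1 b & boundary b = z.

(* For every face F, the reduced homology of link F vanishes in all degrees
   below dim (link F) = (\max_(G in link K F) #|G|) - 1. *)
Definition Cohen_Macaulay_complex K : Prop :=
  forall F, F \in K -> forall m, (m < \max_(G in link K F) #|G|)%N ->
    homology_vanishes (link K F) m.

End SimplicialComplexes.

(* The order complex is that of the whole of P, bounds included; the complex of
   the proper part is its link at [set \bot; \top]. Coefficients range over all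
   commutative rings, in particular over Z and over all fields. *)
Definition Cohen_Macaulay disp (P : finTBPOrderType disp) : Prop :=
  forall R : comNzRingType, Cohen_Macaulay_complex R (order_complex P).

(* Main.v *)
(* The flag of an ordered partition is the set of the unions of its initial
   segments of blocks. In terms of flags, the order is reverse inclusion, so
   the intervals above a partition are Boolean, and there any ordering of the
   atoms is recursive. The atoms of the whole poset are ordered by the sum of
   the elements of the members of their flags. If an atom p is not the least
   one below y, then p has an inversion inside a block of y, hence one that is
   separated by a single member of its flag; exchanging the two elements in
   that member gives an earlier atom q, and p and q are covered by a common
   element below y.
   A recursive atom ordering yields a CL-labeling with integer labels: an edge
   following s_j gets a label below that of s_j when its upper end covers an
   earlier atom, and above it otherwise (Bjorner and Wachs). In a graded poset
   it also yields Cohen-Macaulayness: by Mayer-Vietoris one can adjoin the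
   intervals [s_j, 1] one at a time, because [s_j, 1] meets the union of the
   previous ones in the union of the [z, 1] over an initial segment of the
   atoms z of [s_j, 1]. *)
Require Import Defs.
From mathcomp Require Import all_boot all_order all_algebra.
From mathcomp Require Import ring zify.

Set Implicit Arguments.
Unset Strict Implicit.
Unset Printing Implicit Defensive.

Import Order.Theory GRing.Theory Num.Theory.

(** * Homology of simplicial complexes *)

Section Homology.
Variables (T : finType) (R : comNzRingType).
Implicit Types (K L : {set {set T}}) (F G : {set T}) (c z : {ffun {set T} -> R}).
Local Open Scope ring_scope.

(** The sign of the facet [G] in the boundary of [x |: G], for [x] outside [G]. *)
Definition incidence (x : T) G : R :=
  (-1) ^+ #|[set y in G | (enum_rank y < enum_rank x)%N]|.

Lemma boundaryE c G :
  boundary c G = \sum_(x | x \notin G) incidence x G * c (x |: G).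
Proof. by rewrite ffunE. Qed.

Lemma incidenceU x y G : y \notin G ->
  incidence x (y |: G) = (-1) ^+ (enum_rank y < enum_rank x)%N * incidence x G.
Proof.
move=> yG; rewrite /incidence -exprD; congr (_ ^+ _).
rewrite (cardsD1 y) !inE eqxx /=; congr addn.
apply: eq_card => z; rewrite !inE; case: eqP => // ->.
by rewrite (negPf yG).
Qed.

Lemma incidence_sq x G : incidence x G * incidence x G = 1.
Proof. by rewrite /incidence -exprD addnn -mul2n exprM sqrrN !expr1n. Qed.

Lemma incidence_swap (x y : T) : x != y ->
  (-1) ^+ (enum_rank y < enum_rank x)%N = - (-1) ^+ (enum_rank x < enum_rank y)%N
    :> R.
Proof.
move=> xy; case: ltngtP => [||/val_inj/enum_rank_inj eyx]; rewrite ?opprK //.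
by rewrite eyx eqxx in xy.
Qed.

Lemma boundaryD c c' : boundary (c + c') = boundary c + boundary c'.
Proof.
apply/ffunP=> G; rewrite [RHS]ffunE !boundaryE -big_split; apply: eq_bigr => x _ /=.
by rewrite ffunE mulrDr.
Qed.

Lemma boundaryN c : boundary (- c) = - boundary c.
Proof.
apply/ffunP=> G; rewrite [RHS]ffunE !boundaryE -sumrN; apply: eq_bigr => x _.
by rewrite ffunE mulrN.
Qed.

(** Adding [x] and then [y] to [G], or [y] and then [x], gives the same face with opposite signs, so
    the terms cancel in pairs. *)
Lemma boundary_boundary c : boundary (boundary c) = 0.
Proof.
apply/ffunP=> G; rewrite boundaryE ffunE.
pose t x y := incidence x G * (incidence y (x |: G) * c (y |: (x |: G))).
have tN x y : x \notin G -> y \notin G -> x != y -> t x y = - t y x.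
  move=> xG yG xy; rewrite /t !incidenceU // setUCA (incidence_swap xy); ring.
rewrite (eq_bigr (fun x => \sum_(y | (y \notin G) && (x != y)) t x y)); last first.
  move=> x xG; rewrite boundaryE big_distrr /=; apply: eq_bigl => y.
  by rewrite !inE negb_or andbC eq_sym.
pose lt (x y : T) := (enum_rank x < enum_rank y)%N.
have -> : \sum_(x | x \notin G) \sum_(y | (y \notin G) && (x != y)) t x y =
    \sum_(x | x \notin G) \sum_(y | (y \notin G) && lt x y) t x y +
    \sum_(x | x \notin G) \sum_(y | (y \notin G) && lt y x) t x y.
  rewrite -big_split; apply: eq_bigr => x xG /=; rewrite (bigID (lt x)) /=.
  congr (_ + _); apply: eq_bigl => y; rewrite -andbA; congr (_ && _);
  rewrite /lt -(inj_eq enum_rank_inj) -(inj_eq val_inj) /=; case: ltngtP => //.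
rewrite [X in _ + X](exchange_big_dep (fun y => y \notin G)) /=; last first.
  by move=> x y _ /andP[].
rewrite -big_split big1 //= => x xG; apply/eqP; rewrite addr_eq0 -sumrN; apply/eqP.
apply: eq_big => [y|y /andP[yG xy]]; first by rewrite xG andbC.
by apply: tN => //; apply: contraTneq xy => ->; rewrite /lt ltnn.
Qed.

Lemma simplicial_chainD K m c c' : simplicial_chain K m c ->
  simplicial_chain K m c' -> simplicial_chain K m (c + c').
Proof. by move=> hc hc' F hF; rewrite ffunE hc ?hc' ?addr0. Qed.

Lemma simplicial_chainN K m c : simplicial_chain K m c -> simplicial_chain K m (- c).
Proof. by move=> hc F hF; rewrite ffunE hc ?oppr0. Qed.

Lemma simplicial_chainS K L m c : K \subset L -> simplicial_chain K m c ->
  simplicial_chain L m c.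
Proof.
move=> /subsetP KL hc F hF; apply: hc; apply: contra hF => /andP[/KL-> ->] //.
Qed.

Definition simplicial_complex K := forall F G, F \in K -> G \subset F -> G \in K.

Lemma simplicial_chain_boundary K m c : simplicial_complex K ->
  simplicial_chain K m.+1 c -> simplicial_chain K m (boundary c).
Proof.
move=> Kc hc F hF; rewrite boundaryE big1 // => x xF; rewrite hc ?mulr0 //.
apply: contra hF; rewrite cardsU1 xF eqSS => /andP[/Kc-> //].
exact: subsetUr.
Qed.

(** Joining faces with [v] is a contracting homotopy: up to sign, the filling of a cycle [z] takes
    on a face containing [v] the value of [z] on that face without [v]. *)
Lemma homology_vanishes_cone K v : simplicial_complex K ->
    (forall F, F \in K -> v |: F \in K) ->
  forall m, homology_vanishes R K m.
Proof.
move=> Kc Kv m z hz dz.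
exists [ffun F : {set T} => if v \in F then incidence v (F :\ v) * z (F :\ v) else 0].
  move=> F hF; rewrite ffunE; case: ifP => // vF; rewrite hz ?mulr0 //.
  apply: contra hF => /andP[/Kv]; rewrite setD1K // => -> /eqP <-.
  by rewrite (cardsD1 v F) vF add1n eqxx.
apply/ffunP=> F; rewrite boundaryE.
have [vF|vF] := boolP (v \in F); last first.
  rewrite (bigD1 v) //= ffunE setU11 setU1K // mulrA incidence_sq mul1r.
  rewrite big1 ?addr0 // => x /andP[xF xv].
  by rewrite ffunE !inE eq_sym (negPf xv) (negPf vF) mulr0.
(* On a face [F] containing [v], the cycle condition at [F :\ v] expresses [z F] by the values of
   [z] on the faces [x |: (F :\ v)]. *)
have /ffunP/(_ (F :\ v)) := dz; rewrite boundaryE ffunE (bigD1 v) ?setD11 //=.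
rewrite setD1K // => /(congr1 ( *%R (incidence v (F :\ v)))).
rewrite mulr0 mulrDr mulrA incidence_sq mul1r => /eqP.
rewrite addr_eq0 => /eqP->; rewrite big_distrr -sumrN; apply: eq_big => [x|x xF].
  rewrite !inE negb_and negbK; case: eqP => [->|] //=; first by rewrite vF.
  by rewrite andbT.
have xv : x != v by apply: contraNneq xF => ->.
rewrite ffunE !inE vF orbT.
have -> : (x |: F) :\ v = x |: (F :\ v).
  by rewrite setDUl; congr (_ :|: _); apply/setDidPl; rewrite disjoints1 inE.
rewrite -{1}(setD1K vF) !incidenceU ?inE ?eqxx ?(negPf xF) ?andbF //.
rewrite /= (incidence_swap xv); set e := (-1) ^+ _.
have e2 : e * e = 1 by rewrite -expr2 sqrr_sign.
have eM (a b c : R) : e * a * (e * b * c) = e * e * (b * (a * c)) by ring.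
by rewrite !mulNr eM e2 mul1r.
Qed.

(* Mayer-Vietoris: split a cycle along K1; the boundary of the first part is a
   cycle of the intersection. *)
Lemma homology_vanishesU K1 K2 m :
    simplicial_complex K1 -> simplicial_complex K2 ->
    homology_vanishes R K1 m -> homology_vanishes R K2 m ->
    (0 < m -> homology_vanishes R (K1 :&: K2) m.-1)%N ->
  homology_vanishes R (K1 :|: K2) m.
Proof.
move=> K1c K2c h1 h2 h12 z hz dz.
pose z1 : {ffun {set T} -> R} := [ffun F => if F \in K1 then z F else 0].
pose z2 := z - z1.
have hz1 : simplicial_chain K1 m z1.
  move=> F; rewrite ffunE; case: ifP => //= FK1 cF; apply: hz.
  by rewrite negb_and cF orbT.
have hz2 : simplicial_chain K2 m z2.
  move=> F hF; rewrite !ffunE; case: ifP => FK1; first by rewrite subrr.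
  by rewrite subr0 hz // inE FK1.
have dz12 : boundary z1 = - boundary z2.
  by apply/eqP; rewrite -addr_eq0 -boundaryD /z2 addrC subrK dz.
(* [w] corrects the two parts of [z]: [z1 - w] and [z2 + w] are cycles. For [m = 0] the boundary of
   [z1] is zero, and [w = 0] serves. *)
have [w hw dw] : exists2 w, simplicial_chain (K1 :&: K2) m w & boundary w = boundary z1.
  case: m h12 {h1 h2 hz} hz1 hz2 => [|m] h12 hz1 hz2.
    exists 0 => [F _|]; first by rewrite ffunE.
    apply/ffunP=> F; rewrite !boundaryE !big1 // => x xF; last by rewrite ffunE mulr0.
    by rewrite hz1 ?mulr0 // cardsU1 xF andbF.
  apply: h12 => // [F|]; last exact: boundary_boundary.
  rewrite inE -andbA negb_and => /orP[F1|F2].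
    by rewrite (simplicial_chain_boundary K1c hz1) // negb_and F1.
  by rewrite dz12 ffunE (simplicial_chain_boundary K2c hz2) ?oppr0.
have [b1 hb1 db1] : exists2 b, simplicial_chain K1 m.+1 b & boundary b = z1 - w.
  apply: h1; last by rewrite boundaryD boundaryN dw subrr.
  apply: simplicial_chainD => //; apply/simplicial_chainN.
  exact: simplicial_chainS (subsetIl _ _) hw.
have [b2 hb2 db2] : exists2 b, simplicial_chain K2 m.+1 b & boundary b = z2 + w.
  apply: h2; last by rewrite boundaryD dw dz12 subrr.
  by apply: simplicial_chainD => //; apply: simplicial_chainS (subsetIr _ _) hw.
exists (b1 + b2).
  by apply: simplicial_chainD;
    [apply: simplicial_chainS hb1|apply: simplicial_chainS hb2];
    rewrite ?subsetUl ?subsetUr.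
by rewrite boundaryD db1 db2 addrACA addNr addr0 /z2 addrC subrK.
Qed.

(** The Cohen-Macaulay condition with a prescribed bound in place of the dimensions of the links,
    which makes it inductive over unions and cones. [D] plays the role of the largest number of
    vertices of a face. *)
Definition acyclic_links_upto K (D : nat) :=
  forall F m, F \in K -> (m + #|F| < D)%N -> homology_vanishes R (link K F) m.

Lemma simplicial_complex_link K F : simplicial_complex K ->
  simplicial_complex (link K F).
Proof.
move=> Kc G H; rewrite !inE => /andP[dFG FGK] HG.
rewrite (disjointWr HG) //=; apply: Kc FGK _; exact: setUS.
Qed.

Lemma link_notin K F : simplicial_complex K -> F \notin K -> link K F = set0.
Proof.
move=> Kc FK; apply/setP=> G; rewrite !inE; apply/negP=> /andP[_ FGK].
by rewrite (Kc _ _ FGK) ?subsetUl in FK.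
Qed.

(** Links commute with unions and intersections, so Mayer-Vietoris applies to each link. The
    intersection enters one degree lower, hence its smaller bound. *)
Lemma acyclic_links_uptoU K1 K2 D :
    simplicial_complex K1 -> simplicial_complex K2 ->
    acyclic_links_upto K1 D.+1 -> acyclic_links_upto K2 D.+1 ->
    acyclic_links_upto (K1 :&: K2) D ->
  acyclic_links_upto (K1 :|: K2) D.+1.
Proof.
move=> K1c K2c h1 h2 h12 F m FK mD.
have -> : link (K1 :|: K2) F = link K1 F :|: link K2 F.
  by apply/setP=> G; rewrite !inE andb_orr.
have [F1|F1] := boolP (F \in K1); last first.
  rewrite (link_notin K1c) // set0U; apply: h2 => //.
  by move: FK; rewrite inE (negPf F1).
have [F2|F2] := boolP (F \in K2); last first.
  by rewrite (link_notin K2c) // setU0; apply: h1.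
apply: homology_vanishesU (h1 _ _ F1 mD) (h2 _ _ F2 mD) _.
- exact: simplicial_complex_link.
- exact: simplicial_complex_link.
case: m mD => //= m mD _.
have -> : link K1 F :&: link K2 F = link (K1 :&: K2) F.
  by apply/setP=> G; rewrite !inE; case: [disjoint _ & _].
by apply: h12; rewrite // inE F1.
Qed.

Definition cone v L : {set {set T}} := [set F : {set T} | F :\ v \in L].

(** The link of a face containing the apex is a link in [L] of a face with one vertex fewer; the
    link of any other face is again a cone with apex [v]. *)
Lemma acyclic_links_upto_cone L v D :
    simplicial_complex L -> (forall F, F \in L -> v \notin F) ->
  acyclic_links_upto L D -> acyclic_links_upto (cone v L) D.+1.
Proof.
move=> Lc vL hL F m; rewrite inE => FL mD.
have Kc : simplicial_complex (cone v L).
  by move=> G H; rewrite !inE => /Lc h HG; apply: h; apply: setSD.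
have [vF|vF] := boolP (v \in F).
  have -> : link (cone v L) F = link L (F :\ v).
    apply/setP=> G; rewrite !inE.
    have [vG|vG] := boolP (v \in G).
      have -> : [disjoint F & G] = false by apply/negP=> /disjointFr/(_ vF); rewrite vG.
      apply/esym/negP=> /andP[_ /vL]; rewrite inE vG orbT //.
    have -> : [disjoint F & G] = [disjoint F :\ v & G].
      rewrite -!setI_eq0 setIDAC; congr (_ == _); apply/esym/setDidPl.
      by rewrite disjoint_sym disjoints1 inE negb_and vG orbT.
    rewrite setDUl (_ : G :\ v = G) //.
    by apply/setDidPl; rewrite disjoint_sym disjoints1.
  by apply: hL => //; move: mD; rewrite (cardsD1 v F) vF addnCA ltnS.
apply: (@homology_vanishes_cone _ v); first exact: simplicial_complex_link.
move=> G; rewrite !inE => /andP[dFG FGL].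
rewrite -setI_eq0 setIUr (disjoint_setI0 dFG) setU0 setI_eq0 disjoint_sym disjoints1 vF /=.
by rewrite setUCA setDUl setDv set0U.
Qed.
End Homology.

(** * Recursive atom orderings and the Cohen-Macaulay property *)

Section AtomOrderingTheory.
Variables (disp : Order.disp_t) (P : finTBPOrderType disp).
Implicit Types (x y z a b : P) (s t : seq P).
Local Open Scope order_scope.

Lemma covers_lt x y : covers x y -> x < y.
Proof. by case/andP. Qed.

Lemma covers_inj x a b : covers x a -> covers x b -> a <= b -> a = b.
Proof.
move=> /andP[xa _] /andP[_ /forallP/(_ a)]; rewrite xa /= => ab.
by rewrite le_eqVlt (negPf ab) orbF => /eqP.
Qed.

Lemma covers_exists x y : x < y -> exists2 a, covers x a & a <= y.
Proof.
have [m] := ubnP #|[set z | x < z < y]|; elim: m y => // m IH y.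
rewrite ltnS => lem xy; case: (boolP (covers x y)) => [xcy|]; first by exists y.
rewrite negb_and xy /= negb_forall => /existsP[z]; rewrite negbK => /andP[xz zy].
have [|//|a xa az] := IH z; last by exists a => //; apply: le_trans az (ltW zy).
apply: leq_trans lem; apply: proper_card; apply/properP; split.
  by apply/subsetP=> u; rewrite !inE => /andP[-> /lt_trans->].
by exists z; rewrite !inE ?xz ?zy //= ltxx.
Qed.

Section RecursiveAtomOrderingTheory.
Variables (x : P) (s : seq P).
Hypothesis rao : recursive_atom_ordering x s.

Lemma rao_uniq : uniq s. Proof. by case: rao. Qed.

Lemma rao_mem a : (a \in s) = covers x a. Proof. by case: rao. Qed.

Lemma rao_nth j : (j < size s)%N -> covers x (nth \bot s j).
Proof. by move=> js; rewrite -rao_mem mem_nth. Qed.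

Lemma rao_late j : (j < size s)%N ->
  exists t1 t2, [/\ recursive_atom_ordering (nth \bot s j) (t1 ++ t2),
    all (fun b => has (fun a => covers a b) (take j s)) t1
    & ~~ has (fun b => has (fun a => covers a b) (take j s)) t2].
Proof. by case: rao => _ _ h _ /h. Qed.

Lemma rao_exchange i k y : (i < k < size s)%N ->
  nth \bot s i < y -> nth \bot s k < y ->
  exists j z, [/\ (j < k)%N, covers (nth \bot s j) z, covers (nth \bot s k) z & z <= y].
Proof. by case: rao => _ _ _ h; apply: h. Qed.

Lemma rao_nth_inj i k : (i < size s)%N -> (k < size s)%N ->
  nth \bot s i <= nth \bot s k -> i = k.
Proof.
move=> is_ ks le_ik; apply/eqP; rewrite -(nth_uniq \bot is_ ks rao_uniq).
exact/eqP/(covers_inj (rao_nth is_) (rao_nth ks)).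
Qed.

End RecursiveAtomOrderingTheory.

(** * Order complexes of unions of upper intervals *)

Section CohenMacaulay.
Variables (rk : P -> nat) (R : comNzRingType).
Hypothesis rkS : forall x y, covers x y -> rk y = (rk x).+1.

Lemma rk_lt x y : x < y -> (rk x < rk y)%N.
Proof.
have [m] := ubnP #|[set z | x < z]|; elim: m x => // m IH x.
rewrite ltnS => lem xy; have [a xa ay] := covers_exists xy.
move: ay; rewrite le_eqVlt => /orP[/eqP<-|ay]; first by rewrite (rkS xa).
apply: ltn_trans (IH a _ ay); first by rewrite (rkS xa).
apply: leq_trans lem; apply: proper_card; apply/properP.
split; first by apply/subsetP=> u; rewrite !inE; apply/lt_trans/covers_lt.
by exists a; rewrite !inE ?ltxx ?covers_lt.
Qed.

Lemma rk_le x y : x <= y -> (rk x <= rk y)%N.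
Proof. by rewrite le_eqVlt => /orP[/eqP->|/rk_lt/ltnW]. Qed.

Lemma card_chain (F : {set P}) : F \in order_complex P ->
  (#|F| <= (rk \top - rk \bot).+1)%N.
Proof.
rewrite inE => /'forall_in_forall_inP Fc.
pose f x : 'I_(rk \top - rk \bot).+1 := inord (rk x - rk \bot).
rewrite -[X in (_ <= X)%N]card_ord -(card_in_imset (f := f)) ?max_card //.
move=> x y xF yF /(congr1 val); rewrite /f /=.
have b z : (rk \bot <= rk z)%N by apply/rk_le/le0x.
rewrite !inordK ?ltnS ?leq_sub2r ?rk_le ?lex1 // => e.
have {e}exy : rk x = rk y by rewrite -(subnK (b x)) e subnK.
case: (comparable_ltgtP (Fc x xF y yF)) => // /rk_lt; by rewrite exy ltnn.
Qed.

Definition chains_in (U : {set P}) : {set {set P}} :=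
  [set F in order_complex P | F \subset U].

Lemma chains_in_complex U : simplicial_complex (chains_in U).
Proof.
move=> F G; rewrite !inE => /andP[/'forall_in_forall_inP Fc FU] GF.
rewrite (subset_trans GF) // andbT; apply/'forall_in_forall_inP=> x xG y yG.
by apply: Fc; apply: (subsetP GF).
Qed.

(** For nonempty [s], [chains_in (above s)] is the union of the order complexes of the intervals
    from a member of [s] up to [\top]. *)
Definition above s : {set P} := [set y | has (fun a => a <= y) s].

Lemma above_upset s y z : y <= z -> y \in above s -> z \in above s.
Proof.
rewrite !inE => yz /hasP[a as_ ay]; apply/hasP; exists a => //.
exact: le_trans yz.
Qed.

(** If a chain contains some [u] not above [a], its members below [u] are not above [a] either, so
    they are above a member of [s]; its members above [u] inherit this from [u]. *)
Lemma chains_in_above_rcons s a :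
  chains_in (above (rcons s a)) = chains_in (above s) :|: chains_in (above [:: a]).
Proof.
apply/setP=> F; rewrite !inE -andb_orr.
case: (boolP [forall _ in F, _]) => //= /'forall_in_forall_inP Fc.
apply/idP/orP => [Fs|[] /subsetP Fs]; last first.
- by apply/subsetP=> u /Fs; rewrite !inE has_rcons /= orbF => ->.
- by apply/subsetP=> u /Fs; rewrite !inE has_rcons /= => ->; rewrite orbT.
have [|/subsetPn[u uF uNa]] := boolP (F \subset above [:: a]); [by right|left].
have inFs v : v \in F -> ~~ (a <= v) -> v \in above s.
  by move=> /(subsetP Fs); rewrite !inE has_rcons => /orP[->|].
rewrite inE /= orbF in uNa.
apply/subsetP=> w wF; case/orP: (Fc w wF u uF) => [wu|uw].
  by apply: inFs => //; apply: contra uNa => /le_trans; apply.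
exact: above_upset uw (inFs u uF uNa).
Qed.

(** Everything strictly above [x] is above one of its covers, and [x] is comparable to all of it. *)
Lemma chains_in_cone x s : (forall a, (a \in s) = covers x a) ->
  chains_in (above [:: x]) = cone x (chains_in (above s)).
Proof.
move=> hs; apply/setP=> F; rewrite !inE; apply/andP/andP => -[].
  move=> /'forall_in_forall_inP Fc /subsetP Fx; split.
    apply/'forall_in_forall_inP=> u /setD1P[_ uF] v /setD1P[_ vF].
    exact: Fc.
  apply/subsetP=> u /setD1P[ux /Fx]; rewrite !inE /= orbF => xu.
  have /covers_exists[a] : x < u by rewrite lt_def ux.
  by rewrite -hs => as_ au; apply/hasP; exists a.
move=> /'forall_in_forall_inP Fc /subsetP Fs.
have xF u : u \in F -> x <= u.
  move=> uF; have [->//|ux] := eqVneq u x.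
  have := Fs u; rewrite !inE ux uF => /(_ isT)/hasP[a].
  by rewrite hs => /covers_lt/ltW; apply: le_trans.
split; last by apply/subsetP=> u /xF; rewrite inE /= orbF.
apply/'forall_in_forall_inP=> u uF v vF.
have [->|ux] := eqVneq u x; first by rewrite /Order.comparable xF.
have [->|vx] := eqVneq v x; first by rewrite /Order.comparable xF ?orbT.
by apply: Fc; rewrite !inE ?ux ?vx.
Qed.

(** An element above both the [k]-th atom and an earlier one is, by the exchange condition, above
    some [z] that covers the [k]-th atom and an earlier one; such a [z] belongs to [t1]. *)
Lemma above_late x s k t1 t2 : recursive_atom_ordering x s -> (k < size s)%N ->
    recursive_atom_ordering (nth \bot s k) (t1 ++ t2) ->
    all (fun b => has (fun a => covers a b) (take k s)) t1 ->
    ~~ has (fun b => has (fun a => covers a b) (take k s)) t2 ->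
  above (take k s) :&: above [:: nth \bot s k] = above t1.
Proof.
move=> rao ks raok /allP late1 late2; apply/setP=> y; rewrite !inE /= orbF.
have nth_take_s j : (j < k)%N -> nth \bot s j \in take k s.
  by move=> jk; rewrite -(nth_take \bot jk) mem_nth // size_takel // ltnW.
apply/andP/hasP => [[/hasP[a /(nthP \bot)[i]]]|[z zt1 zy]]; last first.
  have /covers_lt kz : covers (nth \bot s k) z by rewrite -(rao_mem raok) mem_cat zt1.
  split; last exact: ltW (lt_le_trans kz zy).
  have /hasP[a as_ /covers_lt az] := late1 _ zt1.
  by apply/hasP; exists a => //; exact: ltW (lt_le_trans az zy).
rewrite size_takel ?(ltnW ks) // => ik; rewrite nth_take // => <- iy ky.
have is_ := ltn_trans ik ks.
(* Distinct atoms are incomparable, so [y] lies strictly above both. *)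
have lt_iy : nth \bot s i < y.
  rewrite lt_neqAle iy andbT; apply: contraTneq ky => <-.
  by apply/negP=> /(rao_nth_inj rao ks is_) eik; rewrite eik ltnn in ik.
have lt_ky : nth \bot s k < y.
  rewrite lt_neqAle ky andbT; apply: contraTneq iy => <-.
  by apply/negP=> /(rao_nth_inj rao is_ ks) eik; rewrite eik ltnn in ik.
have ik_s : (i < k < size s)%N by rewrite ik.
have [j [z [jk jz kz zy]]] := rao_exchange rao ik_s lt_iy lt_ky.
exists z => //; move: kz; rewrite -(rao_mem raok) mem_cat => /orP[//|zt2].
case/hasP: late2; exists z => //; apply/hasP; exists (nth \bot s j) => //.
exact: nth_take_s.
Qed.

Lemma chains_inI U V : chains_in (U :&: V) = chains_in U :&: chains_in V.
Proof.
by apply/setP=> F; rewrite !inE subsetI; case: [forall _ in F, _]; rewrite //= andbF.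
Qed.

Lemma cone_above_acyclic a t D : recursive_atom_ordering a t ->
    acyclic_links_upto R (chains_in (above t)) D ->
  acyclic_links_upto R (chains_in (above [:: a])) D.+1.
Proof.
move=> raot hD; rewrite (chains_in_cone (rao_mem raot)).
apply: acyclic_links_upto_cone hD; first exact: chains_in_complex.
move=> F; rewrite !inE => /andP[_ /subsetP Ft]; apply/negP=> /Ft.
rewrite inE => /hasP[b]; rewrite (rao_mem raot) => /covers_lt ab ba.
by have := lt_le_trans ab ba; rewrite ltxx.
Qed.

Lemma rao_nil x : recursive_atom_ordering x [::] -> x = \top.
Proof.
move=> rao; apply/eqP; rewrite -[_ == _]negbK; apply/negP=> xNtop.
have /covers_exists[b] : x < \top by rewrite lt_neqAle xNtop lex1.
by rewrite -(rao_mem rao).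
Qed.

(** Induction on the corank of [x], then on [k]. The interval added last is a cone over the union of
    the intervals above its own atoms, and it meets the earlier ones in the union over the initial
    segment [t1]; this is why all nonempty initial segments are treated. *)
Lemma rao_acyclic_take x s k : recursive_atom_ordering x s -> (0 < k <= size s)%N ->
  acyclic_links_upto R (chains_in (above (take k s))) (rk \top - rk x).
Proof.
have [m] := ubnP (rk \top - rk x)%N; elim: m x s k => // m IH x s k.
rewrite ltnS => lem rao; elim: k => // k IHk /= ks.
have xa := rao_nth rao ks; set a := nth \bot s k in xa.
have Dx : (rk \top - rk x = (rk \top - rk a).+1)%N.
  by rewrite (rkS xa) subnSK // -(rkS xa) rk_le // lex1.
have lt_a : (rk \top - rk a < m)%N by rewrite -ltnS -Dx.
have [t1 [t2 [raoa late1 late2]]] := rao_late rao ks.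
have ha : acyclic_links_upto R (chains_in (above [:: a])) (rk \top - rk x).
  rewrite Dx; apply: (cone_above_acyclic raoa).
  (* Without atoms, [a] is [\top] and the bound required of the base of the cone is 0. *)
  case: (posnP (size (t1 ++ t2))) => [/size0nil t0|t_gt0].
    move: raoa; rewrite t0 => /rao_nil; rewrite -/a => ->.
    by rewrite subnn => F i _; rewrite ltn0.
  by rewrite -(take_size (t1 ++ t2)); apply: IH; rewrite ?t_gt0 ?leqnn.
rewrite (take_nth \bot) // chains_in_above_rcons -/a.
have [k0|k_gt0] := posnP k.
  suff -> : chains_in (above (take k s)) :|: chains_in (above [:: a]) =
    chains_in (above [:: a]) by [].
  apply/setUidPr/subsetP=> F; rewrite k0 take0 !inE => /andP[-> /subsetP F0] /=.
  by apply/subsetP=> u /F0; rewrite inE.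
rewrite Dx; apply: acyclic_links_uptoU; try exact: chains_in_complex.
- by rewrite -Dx; apply: IHk; rewrite k_gt0 ltnW.
- by rewrite -Dx.
have above_t1 := above_late rao ks raoa late1 late2.
rewrite -chains_inI above_t1 -(take_size_cat t2 (erefl (size t1))).
apply: IH => //; rewrite size_cat leq_addr andbT.
(* [t1] is not empty, since [\top] lies above both the [k]-th atom and the first one. *)
case: t1 {raoa late1} above_t1 => // /setP/(_ \top).
rewrite !inE /= lex1 andbT => /negP/negP/hasP[]; exists (nth \bot s 0); last exact: lex1.
by rewrite -(nth_take \bot k_gt0) mem_nth // size_takel // ltnW.
Qed.

Lemma rao_Cohen_Macaulay_complex : admits_recursive_atom_ordering P ->
  Cohen_Macaulay_complex R (order_complex P).
Proof.
case=> s rao F FP m mF.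
have eP : order_complex P = chains_in (above [:: \bot]).
  apply/setP=> G; rewrite !inE; case: [forall _ in G, _] => //=; apply/esym/subsetP=> u.
  by rewrite inE /= le0x.
have hP : acyclic_links_upto R (order_complex P) (rk \top - rk \bot).+1.
  rewrite eP; apply: (cone_above_acyclic rao).
  case: (posnP (size s)) => [/size0nil s0|s_gt0].
    move: rao; rewrite s0 => /rao_nil->.
    by rewrite subnn => G i _; rewrite ltn0.
  by rewrite -(take_size s); apply: rao_acyclic_take; rewrite ?s_gt0 ?leqnn.
(* A face of the link of [F] forms a chain together with [F], so the dimension of the link stays
   within the bound. *)
apply: hP => //; rewrite addnC -ltn_subRL; apply: leq_trans mF _.
apply/bigmax_leqP=> G; rewrite inE => /andP[dFG /card_chain].
by rewrite cardsU (disjoint_setI0 dFG) cards0 subn0 leq_subRL ?card_chain.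
Qed.

End CohenMacaulay.

Theorem rao_Cohen_Macaulay (rk : P -> nat) :
    (forall x y, covers x y -> rk y = (rk x).+1) ->
  admits_recursive_atom_ordering P -> Cohen_Macaulay P.
Proof. by move=> rkS rao R; apply: (rao_Cohen_Macaulay_complex (rk := rk)). Qed.

End AtomOrderingTheory.

(** * Recursive atom orderings and CL-shellability *)

Section CLShellability.
Variables (disp : Order.disp_t) (P : finTBPOrderType disp).
Implicit Types (x y z a b u v : P) (s t r m e c : seq P).
Local Open Scope order_scope.

Lemma maximal_chain_cons x y a c :
  maximal_chain x y (a :: c) = covers x a && maximal_chain a y c.
Proof. by rewrite /maximal_chain /= andbA. Qed.

Lemma maximal_chain_nil x y : maximal_chain x y [::] = (x == y).
Proof. by []. Qed.

Lemma maximal_chain_le x y c : maximal_chain x y c -> x <= y.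
Proof.
elim: c x => [|a c IH] x; first by rewrite maximal_chain_nil => /eqP->.
by rewrite maximal_chain_cons => /andP[/covers_lt/ltW xa /IH]; apply: le_trans.
Qed.

Lemma maximal_chain_refl x c : maximal_chain x x c -> c = [::].
Proof.
case: c => // a c; rewrite maximal_chain_cons.
by case/andP=> /covers_lt xa /maximal_chain_le/(lt_le_trans xa); rewrite ltxx.
Qed.

Lemma maximal_chain_exists x y : x <= y -> exists c, maximal_chain x y c.
Proof.
have [m] := ubnP #|[set z | x < z]|; elim: m x => // m IH x.
rewrite ltnS => lem; rewrite le_eqVlt => /orP[/eqP<-|xy].
  by exists [::]; rewrite maximal_chain_nil.
have [a xa ay] := covers_exists xy.
have [|//|c ac] := IH a; last by exists (a :: c); rewrite maximal_chain_cons xa.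
apply: leq_trans lem; apply: proper_card; apply/properP.
split; first by apply/subsetP=> u; rewrite !inE; apply/lt_trans/covers_lt.
by exists a; rewrite !inE ?ltxx ?covers_lt.
Qed.

(* CL_labeling with \bot replaced by x. *)
Definition CL_from x (lam : seq P -> nat -> int) : Prop :=
  (forall c c' k, maximal_chain x \top c -> maximal_chain x \top c' ->
    take k c = take k c' -> forall i, (i < k)%N -> lam c i = lam c' i) /\
  forall u v r e, u < v -> maximal_chain x u r -> maximal_chain v \top e ->
    exists m, [/\ maximal_chain u v m,
      sorted <%O (label_word lam r m e : seq int),
      (forall m', maximal_chain u v m' ->
         sorted <%O (label_word lam r m' e : seq int) -> m' = m)
    & (forall m', maximal_chain u v m' -> m' <> m ->
         label_word lam r m e < label_word lam r m' e)].

(** The first edge of a chain is labeled by its upper end, the others by the labeling chosen above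
    that end; 0 is a default value for the empty chain. *)
Definition cons_labeling (f : P -> int) (Lam : P -> seq P -> nat -> int)
    c i : int :=
  match c, i with
  | [::], _ => 0
  | a :: _, 0 => f a
  | a :: c', i'.+1 => Lam a c' i'
  end.

Section ConsLabeling.
Variables (f : P -> int) (Lam : P -> seq P -> nat -> int).

Lemma label_word_cons a r m e :
  label_word (cons_labeling f Lam) (a :: r) m e = label_word (Lam a) r m e.
Proof.
by rewrite /label_word /= -[(size r).+1]add1n iotaDl -map_comp; apply: eq_map.
Qed.

Lemma label_word_head a m e :
  label_word (cons_labeling f Lam) [::] (a :: m) e =
    f a :: label_word (Lam a) [::] m e.
Proof.
rewrite /label_word /=; congr cons.
by rewrite -[1%N]addn0 iotaDl -map_comp; apply: eq_map.
Qed.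

End ConsLabeling.

Lemma label_word_cons_head (lam : seq P -> nat -> int) a m e :
  exists w, label_word lam [::] (a :: m) e = lam (a :: m ++ e) 0%N :: w.
Proof. by rewrite /label_word /=; eexists. Qed.

(** This makes the label after [f a] a descent exactly when the next element covers an atom
    preceding [a]. *)
Definition late_below (f : P -> int) s a (lam : seq P -> nat -> int) : Prop :=
  forall b c, covers a b ->
    if has (fun a' => covers a' b) (take (index a s) s)
    then lam (b :: c) 0%N < f a else f a < lam (b :: c) 0%N.

(** From [x] to [v], the increasing chain passes through the first atom [a] below [v]: no element
    below [v] covers an earlier atom, so the label after [f a] is larger. Chains through another
    atom start with a larger label and cannot increase. *)
Lemma CL_from_cons x s (f : P -> int) Lam :
    recursive_atom_ordering x s ->
    {in s &, forall a b, (index a s < index b s)%N -> f a < f b} ->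
    (forall a, a \in s -> CL_from a (Lam a) /\ late_below f s a (Lam a)) ->
  CL_from x (cons_labeling f Lam).
Proof.
move=> rao f_incr LamP; split=> [c c' k|].
  case: c c' k => [|a c] [|a' c'] [|k] //; rewrite !maximal_chain_cons.
  case/andP=> xa ac /andP[_ ac'] [eaa' ecc']; rewrite -{}eaa' in ac' *.
  case=> // i ik /=; rewrite -(rao_mem rao) in xa.
  by have [[+ _] _] := LamP a xa; apply; eauto.
move=> u v [|a r] e uv; last first.
  rewrite maximal_chain_cons -(rao_mem rao) => /andP[as_ au] ve.
  have [[_ /(_ u v r e uv au ve)[m [um sm unm lem]]] _] := LamP a as_.
  exists m; rewrite !label_word_cons; split=> // m' um'; rewrite label_word_cons.
    exact: unm.
  exact: lem.
rewrite maximal_chain_nil => /eqP xu ve; rewrite -{u}xu in uv *.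
have hasv : has (fun a => a <= v) s.
  have [a xa av] := covers_exists uv; apply/hasP; exists a => //.
  by rewrite (rao_mem rao).
pose p := find (fun a => a <= v) s; pose a := nth \bot s p.
have ps : (p < size s)%N by rewrite -has_find.
have as_ : a \in s by rewrite mem_nth.
have av : a <= v by exact: (nth_find \bot hasv).
have ia : index a s = p by rewrite index_uniq ?(rao_uniq rao).
have before b : b \in s -> b <= v -> b != a -> (p < index b s)%N.
  move=> bs bv ba; rewrite ltn_neqAle -{1}ia; apply/andP; split.
    by apply: contra ba => /eqP/(congr1 (nth \bot s)); rewrite !nth_index // => ->.
  rewrite leqNgt; apply/negP=> /(before_find \bot).
  by rewrite nth_index // bv.
have [[_ CLa] late_a] := LamP a as_.
have [m [am sm unm lem]] : exists m, [/\ maximal_chain a v m,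
    path <%O (f a) (label_word (Lam a) [::] m e : seq int),
    (forall m', maximal_chain a v m' ->
      path <%O (f a) (label_word (Lam a) [::] m' e : seq int) -> m' = m)
  & (forall m', maximal_chain a v m' -> m' <> m ->
      label_word (Lam a) [::] m e < label_word (Lam a) [::] m' e)].
  move: av; rewrite le_eqVlt => /orP[/eqP eav|av].
    exists [::]; rewrite -eav maximal_chain_nil eqxx; split=> // m'.
      by move=> /maximal_chain_refl.
    by move=> /maximal_chain_refl->.
  have [m [am sm unm lem]] := CLa _ _ [::] e av (eqxx a) ve.
  exists m; split=> // [|m' am' sm']; last by apply: unm => //; apply: path_sorted sm'.
  case: m am {unm lem} sm => [|b m]; first by [].
  rewrite maximal_chain_cons => /andP[ab /maximal_chain_le bv].
  have [w ->] := label_word_cons_head (Lam a) b m e.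
  rewrite /= => ->; rewrite andbT.
  (* If [b] covered an atom preceding [a], that atom would be below [v], against the choice of
     [p]. *)
  have := late_a b (m ++ e) ab; rewrite ia; case: ifP => // /hasP[a' + a'b].
  move=> /(nthP \bot)[i]; rewrite size_takel ?(ltnW ps) // => ip.
  rewrite nth_take // => a'E; have := before_find \bot ip.
  by rewrite a'E (le_trans _ bv) // ltW ?covers_lt.
exists (a :: m); rewrite label_word_head; split=> //.
- by rewrite maximal_chain_cons -(rao_mem rao) as_.
- case=> [|b m']; first by rewrite maximal_chain_nil (lt_eqF uv).
  rewrite maximal_chain_cons -(rao_mem rao) label_word_head => /andP[bs bm'] sm'.
  have [eba|ba] := eqVneq b a; first by rewrite eba in bm' sm' *; rewrite (unm m').
  have bv := maximal_chain_le bm'; have pb := before b bs bv ba.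
  have ibs : (index b s < size s)%N by rewrite index_mem.
  have lt_bv : b < v.
    rewrite lt_neqAle bv andbT; apply: contraTneq av => <-.
    apply/negP=> ab; have := rao_nth_inj rao ps ibs; rewrite nth_index // => /(_ ab) epb.
    by rewrite epb ltnn in pb.
  have lt_av : a < v.
    rewrite lt_neqAle av andbT; apply: contraTneq bv => <-.
    apply/negP=> ab; have := rao_nth_inj rao ibs ps; rewrite nth_index // => /(_ ab) epb.
    by rewrite epb ltnn in pb.
  have pbs : (p < index b s < size s)%N by rewrite pb.
  (* The exchange condition for [a] and [b] gives some [z <= v] covering [b] and an atom before [b];
     the edge from [b] to [z] has a label below [f b]. *)
  have := rao_exchange rao pbs lt_av; rewrite nth_index // => /(_ lt_bv)[j [z [jb jz bz zv]]].
  have [q zq] := maximal_chain_exists zv.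
  have bzq : maximal_chain b v (z :: q) by rewrite maximal_chain_cons bz.
  have [[_ CLb] late_b] := LamP b bs.
  have zlate : Lam b (z :: q ++ e) 0%N < f b.
    have := late_b z (q ++ e) bz; rewrite ifT //; apply/hasP; exists (nth \bot s j) => //.
    by rewrite -(nth_take \bot jb) mem_nth // size_takel // ltnW.
  have [M [_ _ unM leM]] := CLb _ _ [::] e lt_bv (eqxx b) ve.
  have em' : m' = M by apply: unM => //; apply: path_sorted sm'.
  (* The increasing chain from [b] to [v] is lexicographically least, so its first label is at most
     that of the edge to [z]; if it continued [f b] increasingly, the latter label would exceed
     [f b]. *)
  suff : f b < Lam b (z :: q ++ e) 0%N by move/(lt_trans zlate); rewrite ltxx.
  have [zqM|/eqP zqM] := eqVneq (z :: q) M.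
    move: sm'; rewrite em' -zqM; have [w ->] := label_word_cons_head (Lam b) z q e.
    by case/andP.
  have := leM _ bzq zqM; rewrite -em'.
  case: m' bm' sm' {em'} => [|c m' _].
    by rewrite maximal_chain_nil (lt_eqF lt_bv).
  have [w ->] := label_word_cons_head (Lam b) z q e.
  have [w' ->] := label_word_cons_head (Lam b) c m' e.
  by case/andP=> bc _ /Order.SeqLexiOrder.ltxi_lehead; apply: lt_le_trans.
- case=> [|b m']; first by rewrite maximal_chain_nil (lt_eqF uv).
  rewrite maximal_chain_cons -(rao_mem rao) label_word_head => /andP[bs bm'] neq.
  have [eba|ba] := eqVneq b a.
    rewrite eba Order.SeqLexiOrder.ltxi_cons lexx /=; apply: lem; first by rewrite -eba.
    by move=> em'; apply: neq; rewrite eba em'.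
  have fab : f a < f b.
    by apply: f_incr; rewrite // ia; apply: before => //; apply: maximal_chain_le bm'.
  by rewrite Order.SeqLexiOrder.ltxi_cons ltW // lt_geF.
Qed.

(** The labels [f] may be any that increase along [s], so that the induction can place those of the
    atoms above [a] on either side of [f a]. *)
Lemma rao_CL_from x s (f : P -> int) : recursive_atom_ordering x s ->
    {in s &, forall a b, (index a s < index b s)%N -> f a < f b} ->
  exists2 lam, CL_from x lam & forall a c, lam (a :: c) 0%N = f a.
Proof.
have [m] := ubnP #|[set z | x < z]|; elim: m x s f => // m IH x s f.
rewrite ltnS => lem rao f_incr.
suff /fin_all_exists[Lam LamP] a : exists lam,
    a \in s -> CL_from a lam /\ late_below f s a lam.
  by exists (cons_labeling f Lam) => //; apply: (CL_from_cons rao).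
have [as_|_] := boolP (a \in s); last by exists (fun _ _ => 0).
have ia : (index a s < size s)%N by rewrite index_mem.
have [t1 [t2 []]] := rao_late rao ia; rewrite nth_index // => raoa late1 late2.
pose t := t1 ++ t2.
(* [g] increases along [t]; it takes the [size t1] values just below [f a] on [t1], and values above
   [f a] on [t2]. *)
pose g b : int := if (index b t < size t1)%N
  then (f a - Posz (size t1) + Posz (index b t))%R
  else (f a + 1 + Posz (index b t))%R.
have [|b c bt ct|lam CLlam lam0] := IH a t g _ raoa.
- apply: leq_trans lem; apply: proper_card; apply/properP.
  have /covers_lt xa : covers x a by rewrite -(rao_mem rao).
  split; first by apply/subsetP=> u; rewrite !inE; apply: lt_trans xa.
  by exists a; rewrite !inE ?ltxx.
- rewrite /g => bc; case: ifP => hb; case: ifP => hc; lia.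
exists lam => _; split=> // b c ab; rewrite lam0 /g.
have bt : b \in t by rewrite (rao_mem raoa).
have -> : has (fun a' => covers a' b) (take (index a s) s) = (index b t < size t1)%N.
  rewrite index_cat; have [bt1|bt1] := boolP (b \in t1).
    by rewrite index_mem bt1 (allP late1).
  rewrite ltnNge leq_addr; apply/negP=> hb; case/hasP: late2; exists b => //.
  by move: bt; rewrite mem_cat (negPf bt1).
case: ifP => hb; rewrite ?hb; lia.
Qed.

Theorem rao_CL_shellable : admits_recursive_atom_ordering P -> CL_shellable P.
Proof.
case=> s rao; pose f a : int := Posz (index a s).
have [|lam CLlam _] := rao_CL_from (f := f) rao; first by move=> a b _ _; rewrite /f; lia.
by exists ring_display, int, lam.
Qed.

End CLShellability.

(** * Flags of ordered partitions *)

Section Flags.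
Variables d n : nat.
Implicit Types (A B U V W : {set 'I_n}) (C F G : {set {set 'I_n}}).
Implicit Types (b v : seq {set 'I_n}) (s t : ordered_partition d n).

Local Notation psub := (fun A B : {set 'I_n} => A \proper B).
Local Notation unions := (scanl (fun A B : {set 'I_n} => A :|: B)).
Local Notation diffs := (pairmap (fun A B : {set 'I_n} => B :\: A)).
Local Notation block := (fun B : {set 'I_n} => (B != set0) && (d %| #|B|)).
Local Notation disj := (fun A B : {set 'I_n} => [disjoint A & B]).

Lemma psub_trans : transitive psub.
Proof. by move=> A B U; apply: proper_trans. Qed.

Lemma psub_irr : irreflexive psub.
Proof. by move=> A; apply: properxx. Qed.

Lemma card_disjU A B : [disjoint A & B] -> #|A :|: B| = #|A| + #|B|.
Proof. by move=> dAB; rewrite cardsU (disjoint_setI0 dAB) cards0 subn0. Qed.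

(** [A] is the union of the blocks already read; an ordered partition starts from [set0]. *)
Lemma unions_chain A b : all block b -> pairwise disj b ->
    all (disj A) b -> d %| #|A| ->
  [/\ path psub A (unions A b), all (fun U => d %| #|U|) (unions A b),
      last A (unions A b) = A :|: \bigcup_(B <- b) B & diffs A (unions A b) = b].
Proof.
elim: b A => [|B b IH] A /=; first by rewrite big_nil setU0.
case/andP=> /andP[B0 dB] bb /andP[Bb bp] /andP[AB Ab] dA.
have dAB : d %| #|A :|: B| by rewrite card_disjU // dvdn_add.
have ABb : all (disj (A :|: B)) b.
  apply/allP=> U Ub; rewrite -setI_eq0 setIUl.
  by rewrite !disjoint_setI0 ?setU0 ?(allP Bb) ?(allP Ab).
have [-> -> -> ->] := IH (A :|: B) bb bp ABb dAB; split=> //.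
- rewrite andbT properE subsetUl subUset subxx /=; apply: contra B0 => BA.
  by rewrite -(setIidPr BA) setI_eq0.
- by rewrite dAB.
- by rewrite big_cons setUA.
- by rewrite setDUl setDv set0U (setDidPl _) // disjoint_sym.
Qed.

Lemma diffs_blocks A v : path psub A v -> all (fun U => d %| #|U|) v -> d %| #|A| ->
  [/\ all block (diffs A v), pairwise disj (diffs A v), all (disj A) (diffs A v)
    & unions A (diffs A v) = v].
Proof.
elim: v A => //= U v IH A /andP[AU Uv] /andP[dU dv] dA.
have [-> -> Udj eUv] := IH U Uv dv dU; have AsU := proper_sub AU.
have dUA : [disjoint A & U :\: A] by rewrite -setI_eq0 setDE setICA setICr setI0.
have UA : A :|: (U :\: A) = U.
  by rewrite setUC setDE setUIl [~: _ :|: _]setUC setUCr setIT; apply/setUidPl.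
have sub W : W \subset U -> all (disj W) (diffs U v).
  by move=> WU; apply: sub_all Udj => B; apply: disjointWl.
split=> //; last by rewrite UA eUv.
- by rewrite andbT setD_eq0 (proper_subn AU) /= cardsD (setIidPr AsU) dvdn_sub.
- by rewrite andbT sub // subsetDl.
- by rewrite dUA sub.
Qed.

Definition chain_of s := unions set0 s.

Lemma chain_ofP s : [/\ path psub set0 (chain_of s),
  all (fun U => d %| #|U|) (chain_of s), last set0 (chain_of s) = setT
  & diffs set0 (chain_of s) = s].
Proof.
case: s => b /= bP; have [bb bp /eqP bT] := and3P bP.
have [|| p1 p2 p3 p4] := @unions_chain set0 b bb bp; rewrite ?cards0 //.
  by apply/allP=> U _; rewrite -setI_eq0 set0I.
by split; rewrite // /chain_of p3 set0U.
Qed.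

Lemma chain_of_exists v : path psub set0 v -> all (fun U => d %| #|U|) v ->
  last set0 v = setT -> exists s, chain_of s = v.
Proof.
move=> v0 dv vT; have [|bb bp b0 ev] := diffs_blocks v0 dv; first by rewrite cards0.
have bP : is_ordered_partition d (diffs set0 v).
  apply/and3P; split=> //; have [|_ _ + _] := unions_chain bb bp b0.
    by rewrite cards0.
  by rewrite ev vT set0U => <-.
by exists (OrderedPartition bP).
Qed.

(** With [set0] added, a flag contains both [set0] and [setT]; for [n = 0] the two coincide. *)
Definition flag s : {set {set 'I_n}} := [set U in set0 :: chain_of s].

Lemma flag_uniq s : uniq (set0 :: chain_of s).
Proof.
have [p _ _ _] := chain_ofP s.
exact: (sorted_uniq psub_trans psub_irr (s := set0 :: chain_of s)).
Qed.

Lemma flag_inj : injective flag.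
Proof.
move=> s t est; apply: val_inj => /=.
have [ps _ _ <-] := chain_ofP s; have [pt _ _ <-] := chain_ofP t; congr (diffs _ _).
suff [->] : set0 :: chain_of s = set0 :: chain_of t by [].
apply: (irr_sorted_eq psub_trans psub_irr) => // U.
by have := congr1 (fun C => U \in C) est; rewrite !inE.
Qed.

Definition is_flag C : Prop :=
  [/\ set0 \in C, setT \in C, {in C, forall U, d %| #|U|}
    & {in C &, forall U V, (U \subset V) || (V \subset U)}].

Lemma flagP s : is_flag (flag s).
Proof.
have [p dv eT _] := chain_ofP s; split=> [||U|U V]; rewrite !inE ?eqxx //.
- by have := mem_last set0 (chain_of s); rewrite eT inE.
- by case/predU1P=> [->|/(allP dv)//]; rewrite cards0.
rewrite -!in_cons => Us Vs.
have := p; rewrite -[path _ _ _]/(sorted psub (set0 :: chain_of s)).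
rewrite (sorted_pairwise psub_trans) => /(pairwiseP set0) pw.
case/(nthP set0): Us => i is_ <-; case/(nthP set0): Vs => j js <-.
case: (ltngtP i j) => [ij|ji|->]; last by rewrite subxx.
  by rewrite proper_sub // pw.
by rewrite orbC proper_sub // pw.
Qed.

Lemma sub_flag C G : is_flag C -> set0 \in G -> setT \in G -> G \subset C -> is_flag G.
Proof.
move=> [_ _ dC cC] G0 GT /subsetP GC; split=> // [U /GC/dC//|U V /GC UC /GC VC].
exact: cC.
Qed.

(** The members are pairwise comparable, so sorting them by cardinality gives a strictly increasing
    chain, with [set0] first and [setT] last. *)
Lemma flag_exists C : is_flag C -> exists s, flag s = C.
Proof.
move=> [C0 CT dC cC].
pose le A B := #|A| <= #|B|; pose c := sort le (enum C).
have le_tr : transitive le by move=> A B U; apply: leq_trans.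
have memc : c =i C by move=> U; rewrite mem_sort mem_enum.
have cs : sorted psub c.
  have : sorted le c by apply: sort_sorted => A B; apply: leq_total.
  have uc : uniq c by rewrite sort_uniq enum_uniq.
  rewrite !sorted_pairwise //; last exact: psub_trans.
  move: uc; rewrite uniq_pairwise => uc lc.
  have := conj uc lc => /andP; rewrite -pairwise_relI.
  apply: (sub_in_pairwise (P := mem C)) => [U V UC VC|]; last first.
    by apply/allP=> U; rewrite memc.
  case/andP=> /= UV leUV; rewrite properEneq UV /=.
  case/orP: (cC U V UC VC) => // VU.
  by have /eqP-> : V == U by rewrite eqEcard VU.
case ec : c cs memc => [|U v] cs memc; first by rewrite -memc in C0.
have U0 : U = set0.
  move: C0; rewrite -memc inE => /predU1P[//|v0].
  have /allP/(_ _ v0) := order_path_min psub_trans cs.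
  by rewrite properE sub0set andbF.
rewrite U0 in ec cs memc.
have [|||s sv] := @chain_of_exists v => //.
- by apply/allP=> V Vv; apply: dC; rewrite -memc inE Vv orbT.
- move: CT cs; rewrite -memc lastI mem_rcons inE => /predU1P[//|].
  rewrite (sorted_pairwise psub_trans) pairwise_rcons => Tb /andP[/allP/(_ _ Tb)].
  by rewrite /= properE subsetT andbF.
by exists s; apply/setP=> V; rewrite -memc inE sv.
Qed.


(** This is what makes the intervals above a partition Boolean. *)
Lemma flag_between s t F : flag t \subset F -> F \subset flag s ->
  exists u, flag u = F.
Proof.
move=> /subsetP tF Fs; have [t0 tT _ _] := flagP t.
by apply: flag_exists; apply: sub_flag (flagP s) (tF _ t0) (tF _ tT) Fs.
Qed.

Lemma merges_flag s t : merges s t -> flag t \subset flag s.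
Proof.
case/existsP=> i /andP[lt_i /eqP et]; apply/subsetP=> U; rewrite !inE /chain_of et.
rewrite -[in X in _ -> X](cat_take_drop i s) (drop_nth set0 (ltn_ord i)).
rewrite (drop_nth set0 lt_i) !scanl_cat /= !mem_cat !inE setUA.
by case/or4P=> ->; rewrite ?orbT.
Qed.

(** Dropping [U] from the flag merges the two blocks that end and begin at [U]. *)
Lemma flag_merges s t U : U \in flag s -> flag t = flag s :\ U -> merges s t.
Proof.
move=> Us et; have [ps _ eT es] := chain_ofP s; have [pt _ _ ett] := chain_ofP t.
have [t0 tT _ _] := flagP t.
have U0 : U != set0 by apply: contraTneq t0 => <-; rewrite et !inE eqxx.
have UT : U != setT by apply: contraTneq tT => <-; rewrite et !inE eqxx.
have [v1 [v2 ev]] : exists v1 v2, chain_of s = v1 ++ U :: v2.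
  by move: Us; rewrite !inE (negPf U0) => /splitPr[v1 v2]; exists v1, v2.
have etv : chain_of t = v1 ++ v2.
  suff [->] : set0 :: chain_of t = set0 :: v1 ++ v2 by [].
  have := flag_uniq s; rewrite ev -cat_cons -(cat1s U) uniq_catCA cat1s => /andP[Uv _].
  apply: (irr_sorted_eq psub_trans psub_irr) => // [|V].
    move: ps; rewrite ev -[path _ _ _]/(sorted psub (set0 :: _)).
    apply: (subseq_sorted psub_trans); rewrite -!cat_cons.
    by apply: cat_subseq; rewrite ?subseq_cons.
  have := congr1 (fun C => V \in C) et; rewrite !inE ev => ->.
  have [->|VU] := eqVneq V U; last by rewrite !mem_cat !inE (negPf VU).
  by apply/esym/negbTE; move: Uv; rewrite !inE !mem_cat; rewrite orbA.
(* [U] is not [setT], so it is not the last member and has a successor [W]; its predecessor [w] may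
   be [set0]. *)
case: v2 ev etv => [|W v2] ev etv.
  by move: eT; rewrite ev last_cat /= => /eqP; rewrite (negPf UT).
set w := last set0 v1.
have [wU UW] : w \proper U /\ U \proper W.
  by move: ps; rewrite ev cat_path /= => /and4P[].
have bs : blocks s = diffs set0 v1 ++ (U :\: w) :: (W :\: U) :: diffs W v2.
  by rewrite -es ev pairmap_cat.
have bt : blocks t = diffs set0 v1 ++ (W :\: w) :: diffs W v2.
  by rewrite -ett etv pairmap_cat.
have lt_i : (size v1).+1 < size s.
  by rewrite bs size_cat size_pairmap /= !addnS !ltnS leq_addr.
apply/existsP; exists (Ordinal (ltnW lt_i)); rewrite lt_i /= bt bs.
have sz : size (diffs set0 v1) = size v1 by rewrite size_pairmap.
rewrite -sz take_size_cat // !nth_cat ltnn subnn ltnNge leqnSn /= subSnn /=.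
rewrite drop_cat ltnNge -addn2 leq_addr /= addKn /= drop0.
suff -> : U :\: w :|: W :\: U = W :\: w by [].
apply/setP=> x; rewrite !inE; have := subsetP (proper_sub wU) x.
by have := subsetP (proper_sub UW) x; case: (x \in w); case: (x \in U);
  case: (x \in W) => //= h1 h2; [have := h2 isT| have := h1 isT].
Qed.

(** Members of [flag s] outside [flag t] can be removed one at a time, and each removal is a
    merge. *)
Lemma connect_flag s t : connect (@merges d n) s t = (flag t \subset flag s).
Proof.
apply/idP/idP=> [/connectP[p]|].
  elim: p s => [|u p IH] s /=; first by move=> _ ->.
  by case/andP=> /merges_flag us /IH h /h; move/subset_trans; apply.
have [m] := ubnP (size s); elim: m s => // m IH s; rewrite ltnS => le_sm ts.
have [st|/subsetPn[U Us Ut]] := boolP (flag s \subset flag t).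
  have -> : s = t by apply: flag_inj; apply/eqP; rewrite eqEsubset st ts.
  exact: connect0.
have [u eu] : exists u, flag u = flag s :\ U.
  by apply: (@flag_between s t); rewrite ?subD1set // subsetD1 ts.
have su : merges s u by apply: flag_merges Us eu.
apply: connect_trans (connect1 su) (IH u _ _).
  by rewrite -(merges_size su).
by rewrite eu subsetD1 ts.
Qed.

End Flags.

(** * The order of Omega *)

Section OmegaOrder.
Variables d n : nat.
Implicit Types (U V W : {set 'I_n}) (C F G : {set {set 'I_n}}).
Implicit Types (s t p q : ordered_partition d n) (a b y z : Omega d n).

Lemma Omega_leE s t : ((Some s : Omega d n) <= Some t)%O = (flag t \subset flag s).
Proof. exact: connect_flag. Qed.

Lemma Omega_ltE s t : ((Some s : Omega d n) < Some t)%O = (flag t \proper flag s).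
Proof.
rewrite lt_def Omega_leE properEneq andbC [RHS]andbC; congr (_ && ~~ _).
by apply/eqP/eqP => [[->]|/flag_inj->].
Qed.

Lemma covers_flagP s t :
  reflect (exists2 U, U \in flag s & flag t = flag s :\ U)
    (covers (Some s : Omega d n) (Some t)).
Proof.
apply: (iffP andP) => [[]|[U Us et]].
  rewrite Omega_ltE => ts /forallP h.
  have [_ [U Us Ut]] := properP ts.
  have [u eu] : exists u : ordered_partition d n, flag u = flag s :\ U.
    by apply: (@flag_between _ _ s t); rewrite ?subD1set // subsetD1 proper_sub.
  exists U; rewrite // -eu; have := h (Some u); rewrite !Omega_ltE eu properD1 //=.
  rewrite properE !subsetD1 (proper_sub ts) Ut /= negbK => stu.
  by apply/eqP; rewrite eqEsubset stu subsetD1 Ut (proper_sub ts).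
rewrite Omega_ltE et properD1 //; split=> //; apply/forallP=> -[u|] //.
rewrite !Omega_ltE et; apply/negP=> /andP[us tu].
have := proper_card us; have := proper_card tu.
rewrite (cardsD1 U (flag s)) Us; lia.
Qed.

Lemma covers_Some s a : covers (Some s : Omega d n) a -> exists t, a = Some t.
Proof. by case: a => [t|] // /covers_lt; exists t. Qed.

(** Supplies the lists [t1] and [t2] of the recursion when [l] tests for covering an earlier
    atom. *)
Lemma covers_arrange (s : ordered_partition d n) a (l : pred (Omega d n)) :
  let e := enum [pred b | covers a b] in
  let u := [seq b <- e | l b] ++ [seq b <- e | ~~ l b] in
  uniq u /\ forall b, (b \in u) = covers a b.
Proof.
move=> e u; have eu : perm_eq u e by apply/permPl/perm_filterC.
by rewrite (perm_uniq eu) enum_uniq; split=> // b; rewrite (perm_mem eu) mem_enum.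
Qed.

(** Two covers of [s] arise by removing one member of the flag each; removing both members gives a
    common cover, which is still below any common upper bound. *)
Lemma rao_Some s (u : seq (Omega d n)) : uniq u ->
  (forall a, (a \in u) = covers (Some s : Omega d n) a) ->
  recursive_atom_ordering (Some s : Omega d n) u.
Proof.
have [m] := ubnP #|flag s|; elim: m s u => // m IH s u; rewrite ltnS => lem uu mu.
split=> // [j ju late|i k y /andP[ik ku]].
  have := mem_nth (Order.bottom : Omega d n) ju; rewrite mu.
  set a := nth _ u j => sa; have [t ea] := covers_Some sa.
  have [ue me] := covers_arrange s a late.
  exists [seq b <- enum [pred b | covers a b] | late b].
  exists [seq b <- enum [pred b | covers a b] | ~~ late b].
  split; last 2 first.
  - exact: filter_all.
  - by rewrite -all_predC; apply: filter_all.
  rewrite ea in sa ue me *; apply: IH => //.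
  have /covers_flagP[U Us ->] := sa.
  by apply: leq_trans lem; rewrite [X in _ < X](cardsD1 U) Us.
have iu := ltn_trans ik ku;
have := mem_nth (Order.bottom : Omega d n) iu.
have := mem_nth (Order.bottom : Omega d n) ku.
have /eqP : nth Order.bottom u i != nth Order.bottom u k by rewrite nth_uniq // ltn_eqF.
rewrite !mu; set a := nth _ u i; set b := nth _ u k => ab sb sa.
have [p ep] := covers_Some sa; have [q eq] := covers_Some sb.
rewrite ep eq in ab sa sb *; case: y => [w|]; last by [].
have /covers_flagP[U Us ep'] := sa; have /covers_flagP[V Vs eq'] := sb.
rewrite !Omega_ltE => /proper_sub wp /proper_sub wq.
have UV : U != V.
  by apply/eqP=> UV; apply: ab; congr Some; apply: flag_inj; rewrite ep' eq' UV.
have [z ez] : exists z : ordered_partition d n, flag z = flag p :\ V.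
  apply: (@flag_between _ _ p w); rewrite ?subD1set // subsetD1 wp.
  by move: wq; rewrite eq' subsetD1 => /andP[].
exists i, (Some z); rewrite -/a ep; split=> //.
- by apply/covers_flagP; exists V; rewrite // ep' in_setD1 eq_sym UV.
- apply/covers_flagP; exists U; first by rewrite eq' in_setD1 UV.
  by rewrite ez ep' eq'; apply/setP=> W; rewrite !inE andbCA.
rewrite Omega_leE ez subsetD1 wp; move: wq; rewrite eq' subsetD1.
by case/andP.
Qed.

Lemma flag_card_inj s : {in flag s &, forall U V, #|U| = #|V| -> U = V}.
Proof.
have [_ _ _ h] := flagP s; move=> U V Us Vs eUV.
by case/orP: (h U V Us Vs) => UV; [|apply/esym]; apply/eqP; rewrite eqEcard UV eUV /=.
Qed.

(** * Maximal flags and the atoms of the poset *)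

Hypothesis d_gt0 : 0 < d.

(** Members of a flag are comparable and have cardinality divisible by [d], so their levels are
    distinct and there are at most [(n %/ d).+1] of them. *)
Definition level U : 'I_(n %/ d).+1 := inord (#|U| %/ d).

Lemma levelE U : level U = #|U| %/ d :> nat.
Proof. by rewrite inordK // ltnS leq_div2r // -[X in _ <= X]card_ord max_card. Qed.

Lemma level_inj s : {in flag s &, injective level}.
Proof.
move=> U V Us Vs /(congr1 val); rewrite /= !levelE => eUV.
apply: (flag_card_inj Us Vs); have [_ _ ds _] := flagP s.
by rewrite -(divnK (ds U Us)) -(divnK (ds V Vs)) eUV.
Qed.

Lemma card_flag_le s : #|flag s| <= (n %/ d).+1.
Proof.
by rewrite -(card_in_imset (@level_inj s)) -[X in _ <= X]card_ord max_card.
Qed.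

Lemma card_flag_ge s k : #|flag s| = (n %/ d).+1 -> k <= n %/ d ->
  exists2 U, U \in flag s & #|U| = k * d.
Proof.
rewrite -(card_in_imset (@level_inj s)) => full kn.
have : inord k \in [set level U | U in flag s].
  suff -> : [set level U | U in flag s] = setT by rewrite inE.
   apply/eqP; rewrite eqEcard subsetT cardsT card_ord. by rewrite /= full.
case/imsetP=> U Us /(congr1 val); rewrite /= levelE inordK // => ->.
by have [_ _ ds _] := flagP s; exists U; rewrite // divnK // ds.
Qed.

Lemma flag_add s (A : {set 'I_n}) k : #|A| = k * d ->
    {in flag s, forall U, (U \subset A) || (A \subset U)} ->
  exists t : ordered_partition d n, flag t = A |: flag s.
Proof.
move=> cA hA; have [s0 sT ds cs] := flagP s.
apply: flag_exists; split; rewrite ?in_setU1 ?s0 ?sT ?orbT //.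
  by move=> U /setU1P[->|/ds//]; rewrite cA dvdn_mull.
move=> U V /setU1P[->|Us] /setU1P[->|Vs]; rewrite ?subxx //; last exact: cs.
- by rewrite orbC hA.
- exact: hA.
Qed.

Lemma subset_of_card U W m : U \subset W -> #|U| <= m <= #|W| ->
  exists A : {set 'I_n}, [/\ U \subset A, A \subset W & #|A| = m].
Proof.
move=> UW /andP[Um mW]; pose c := take (m - #|U|) (enum (W :\: U)).
have cW x : x \in c -> x \in W :\: U by move/mem_take; rewrite mem_enum.
exists (U :|: [set x in c]); split; first exact: subsetUl.
  by rewrite subUset UW; apply/subsetP=> x; rewrite inE => /cW/setDP[].
rewrite card_disjU; last first.
  rewrite -setI_eq0; apply/eqP/setP=> x; rewrite !inE; apply/negP=> /andP[xU /cW].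
  by rewrite inE xU.
rewrite cardsE (card_uniqP _) ?take_uniq ?enum_uniq // size_takel ?subnKC //.
by rewrite -cardE cardsD (setIidPr UW) leq_sub2r.
Qed.

(** The atoms are the flags with a member at each level: where level [k] is missing, a set of size
    [k * d] can be inserted, which gives a strictly smaller partition. *)
Lemma covers_bot s : covers (None : Omega d n) (Some s) = (#|flag s| == (n %/ d).+1).
Proof.
apply/idP/eqP => [/andP[_ /forallP smin]|s_max].
  apply/eqP; rewrite eqn_leq card_flag_le leqNgt; apply/negP=> lt_s.
  have [k kNs] : exists k : 'I_(n %/ d).+1, k \notin [set level U | U in flag s].
    apply/existsP; rewrite -negb_forall; apply/negP=> /forallP full.
    move: lt_s; rewrite -(card_in_imset (@level_inj s)).
    suff -> : [set level U | U in flag s] = setT by rewrite cardsT card_ord ltnn.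
    by apply/setP=> k; rewrite full in_setT.
  have kN U : U \in flag s -> #|U| != k * d.
    move=> Us; apply: contraNneq kNs => eU; apply/imsetP; exists U => //.
    by apply: val_inj; rewrite /= levelE eU mulnK.
  have [s0 sT _ cs] := flagP s.
  have k_gt0 : 0 < k * d by have := kN _ s0; rewrite cards0 lt0n eq_sym.
  have k_ltn : k * d < n.
    have := kN _ sT; rewrite cardsT card_ord ltn_neqAle eq_sym => -> /=.
    by rewrite -leq_divRL // -ltnS.
  pose lo U := (U \in flag s) && (#|U| < k * d).
  pose hi U := (U \in flag s) && (k * d < #|U|).
  have lo0 : lo set0 by rewrite /lo s0 cards0.
  have hiT : hi setT by rewrite /hi sT cardsT card_ord.
  (* [U] and [W] are the members next to the gap on either side; any set between them is comparable
     to the whole flag. *)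
  case: (arg_maxnP (fun U => #|U|) lo0) => U /andP[Us ltU] Umax.
  case: (arg_minnP (fun U => #|U|) hiT) => W /andP[Ws ltW] Wmin.
  have [||A [UA AW cA]] := @subset_of_card U W (k * d).
  - case/orP: (cs U W Us Ws) => // /subset_leq_card; rewrite leqNgt.
    by rewrite (ltn_trans ltU).
  - by rewrite (ltnW ltU) (ltnW ltW).
  have [V Vs|t et] := flag_add (s := s) cA.
    case: (ltngtP #|V| (k * d)) (kN V Vs) => // ltV _.
      rewrite (subset_trans _ UA) //; case/orP: (cs V U Vs Us) => // UV.
      have /eqP-> // : U == V; rewrite eqEcard UV; apply: Umax; exact/andP.
    rewrite (subset_trans AW) ?orbT //; case/orP: (cs V W Vs Ws) => // VW.
    have /eqP-> // : V == W; rewrite eqEcard VW; apply: Wmin; exact/andP.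
  have As : A \notin flag s by apply: contraNN (kN A) _ => //; rewrite cA eqxx.
  have := smin (Some t); rewrite Omega_ltE et properE subsetUr subUset sub1set.
  by rewrite (negPf As).
apply/andP; split; first by [].
apply/forallP=> -[t|]; last by rewrite ltxx.
rewrite negb_and; apply/orP; right.
rewrite Omega_ltE; apply/negP=> /proper_card.
by rewrite s_max ltnNge card_flag_le.
Qed.

End OmegaOrder.

(** * A recursive atom ordering of Omega *)

Section OmegaRAO.
Variables d n : nat.
Implicit Types (U V W Y : {set 'I_n}) (C F G : {set {set 'I_n}}) (x : 'I_n).
Implicit Types (s t p q w z : ordered_partition d n) (a b y : Omega d n).

Definition separators C x x' : {set {set 'I_n}} :=
  [set U in C | (x \in U) && (x' \notin U)].

(** For a flag [C] and a flag [G] inside it: the larger element [x] comes in an earlier block than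
    [x'] for [C], while both lie in one block for [G]. *)
Definition inversion C G x x' : bool :=
  [&& (x' < x)%N, separators C x x' != set0 & separators G x x' == set0].

Definition weight C : nat := \sum_(U in C) \sum_(x in U) (x : nat).

(** If two members [V1 \proper V2] both separate the pair, take [u] in [V2] outside [V1]. According
    to whether [u < x], the pair [x], [u] or the pair [u], [x'] is an inversion with fewer
    separators. *)
Lemma inversion_adjacent C G x x' :
    {in C &, forall U V, (U \subset V) || (V \subset U)} -> G \subset C ->
    inversion C G x x' ->
  exists x1 x1' U, inversion C G x1 x1' /\ separators C x1 x1' = [set U].
Proof.
move=> cC GC; have [m] := ubnP #|separators C x x'|.
elim: m x x' => // m IH x x'; rewrite ltnS => lem inv.
have /and3P[ltx /set0Pn[U1 sU1] /eqP sG] := inv.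
have [/cards1P[U eU]|s_ne1] := boolP (#|separators C x x'| == 1).
  by exists x, x', U.
have [U2 sU2 U12] : exists2 U2, U2 \in separators C x x' & U2 != U1.
  have : 0 < #|separators C x x' :\ U1|.
    by move: s_ne1; rewrite (cardsD1 U1) sU1; case: #|_|.
  by case/card_gt0P=> U2 /setD1P[U21 sU2]; exists U2.
have main V1 V2 : V1 \in separators C x x' -> V2 \in separators C x x' ->
    V1 \proper V2 -> exists x1 x1' U,
  inversion C G x1 x1' /\ separators C x1 x1' = [set U].
  rewrite !inE => /and3P[V1C xV1 x'V1] /and3P[V2C xV2 x'V2] /properP[V12 [u uV2 uV1]].
  have sub1 : separators C x u \proper separators C x x'.
    apply/properP; split; last by exists V2; rewrite !inE V2C xV2 // uV2.
    apply/subsetP=> V; rewrite !inE => /and3P[VC xV uV]; rewrite VC xV /=.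
    case/orP: (cC V V2 VC V2C) => /subsetP VV2; last by rewrite VV2 in uV.
    by apply: contra x'V2 => /VV2.
  have sub2 : separators C u x' \proper separators C x x'.
    apply/properP; split; last by exists V1; rewrite !inE V1C ?xV1 ?x'V1 // ?(negPf uV1).
    apply/subsetP=> V; rewrite !inE => /and3P[VC uV x'V]; rewrite VC x'V andbT /=.
    case/orP: (cC V V1 VC V1C) => /subsetP VV1; last exact: VV1.
    by rewrite VV1 in uV1.
  have sepG (k1 k2 : 'I_n) : separators C k1 k2 \proper separators C x x' ->
      separators G k1 k2 == set0.
    move=> /proper_sub/subsetP sub; rewrite -subset0 -sG; apply/subsetP=> V.
    rewrite !inE => /andP[VG Vz]; rewrite VG /=.
    by have := sub V; rewrite !inE (subsetP GC) // Vz => /(_ isT).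
  have xu : x != u by apply: contraNneq uV1 => <-.
  have [ux|xu'] := ltnP u x.
    apply: (IH x u); first exact: leq_trans (proper_card sub1) lem.
    rewrite /inversion ux sepG // andbT; apply/set0Pn; exists V1.
    by rewrite !inE V1C xV1.
  apply: (IH u x'); first exact: leq_trans (proper_card sub2) lem.
  rewrite /inversion (leq_trans ltx) // sepG // andbT; apply/set0Pn; exists V2.
  by rewrite !inE V2C uV2.
have [U1C U2C] : U1 \in C /\ U2 \in C by move: sU1 sU2; rewrite !inE => /andP[-> _] /andP[].
case/orP: (cC U1 U2 U1C U2C) => U12'; [apply: (main U1 U2)|apply: (main U2 U1)] => //.
  by rewrite properEneq eq_sym U12.
by rewrite properEneq U12.
Qed.

(** The inversion may be taken with a single separator [U]. All other members containing [x] contain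
    [x'] too, so replacing [x] by [x'] in [U] keeps the flag a chain and lowers the weight. *)
Lemma inversion_swap p w x x' : flag w \subset flag p ->
    inversion (flag p) (flag w) x x' ->
  exists q z, [/\ covers (Some p : Omega d n) (Some z),
    covers (Some q : Omega d n) (Some z), flag w \subset flag z,
    #|flag q| = #|flag p| & weight (flag q) < weight (flag p)].
Proof.
move=> wp inv; have [p0 pT dp cp] := flagP p.
have {x x' inv} [x [x' [U [/and3P[ltx _ /eqP sG] sU]]]] := inversion_adjacent cp wp inv.
have : U \in separators (flag p) x x' by rewrite sU set11.
rewrite inE => /and3P[Up xU x'U].
have Uw : U \notin flag w.
  by apply/negP=> Uw; have := in_set0 U; rewrite -sG inE Uw xU x'U.
have other V : V \in flag p -> V != U -> x \in V -> x' \in V.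
  move=> Vp VU xV; rewrite -[_ \in _]negbK; apply: contra VU => x'V.
  by rewrite -in_set1 -sU inE Vp xV.
have wU : flag w \subset flag p :\ U by rewrite subsetD1 wp.
have [z ez] : exists z : ordered_partition d n, flag z = flag p :\ U.
  exact: flag_between wU (subD1set _ _).
pose U' := x' |: (U :\ x).
have xNU' : x \notin U' by rewrite !inE eqxx orbF; apply: contraTneq ltx => ->; rewrite ltnn.
have cU' : #|U'| = #|U|.
  by rewrite cardsU1 !inE (negPf x'U) andbF (cardsD1 x U) xU.
(* [q] adds [U'] to the flag of [z], at the level left free by [U]. *)
have [||q eq] := @flag_add d n z U' (#|U| %/ d).
- by rewrite cU' divnK // dp.
- move=> V; rewrite ez => /setD1P[VU Vp]; have xx'V := other V Vp VU.
  case/orP: (cp V U Vp Up) => [/subsetP VsU|/subsetP UsV]; apply/orP; [left|right].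
    apply/subsetP=> v vV; rewrite !inE VsU // andbT; apply/orP; right.
    by apply: contraNneq x'U => vx; rewrite VsU // xx'V // -vx.
  by apply/subsetP=> v /setU1P[->|/setD1P[_ /UsV//]]; apply/xx'V/UsV.
have U'p : U' \notin flag p.
  by apply: contraNN xNU' => U'p; rewrite (flag_card_inj U'p Up cU').
have U'z : U' \notin flag z by apply: contra U'p; rewrite ez => /setD1P[].
exists q, z; split.
- by apply/covers_flagP; exists U.
- by apply/covers_flagP; exists U'; rewrite eq ?setU11 // setU1K.
- by rewrite ez.
- by rewrite eq cardsU1 U'z ez (cardsD1 U (flag p)) Up.
rewrite eq /weight big_setU1 //= ez (big_setD1 U Up) /= ltn_add2r.
rewrite (big_setD1 x xU) /= big_setU1 ?ltn_add2r //.
by rewrite !inE (negPf x'U) andbF.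
Qed.

(** A member of [flag w] separating the pair would be comparable with [V], yet it would contain [x]
    but not [x'], and [V] contains [x'] but not [x]. *)
Lemma inversion_of_cross p q w U V x x' : flag w \subset flag p ->
    U \in flag q -> V \in flag p -> (x' < x)%N ->
    x \in U :\: V -> x' \in V :\: U ->
  inversion (flag q) (flag w) x x'.
Proof.
move=> wp Uq Vp ltx /setDP[xU xV] /setDP[x'V x'U]; have [_ _ _ cp] := flagP p.
rewrite /inversion ltx /=; apply/andP; split.
  by apply/set0Pn; exists U; rewrite inE Uq xU.
rewrite -subset0; apply/subsetP=> Y; rewrite inE => /and3P[Yw xY x'Y].
case/orP: (cp Y V (subsetP wp Y Yw) Vp) => /subsetP YV.
  by rewrite YV in xV.
by rewrite YV in x'Y.
Qed.

Hypothesis d_gt0 : 0 < d.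

(** Swapping an inversion in [q] lowers its weight, which reduces to a [q] without inversions. Two
    different full flags have different members of equal size, and these yield an inversion in one
    of the two flags. *)
Lemma inversion_free_min p q w : flag w \subset flag p -> flag w \subset flag q ->
    #|flag p| = (n %/ d).+1 -> #|flag q| = (n %/ d).+1 ->
    (forall x x', ~~ inversion (flag p) (flag w) x x') ->
  p = q \/ weight (flag p) < weight (flag q).
Proof.
move=> wp + pmax + pmin; have [m] := ubnP (weight (flag q)).
elim: m q => // m IH q; rewrite ltnS => le_qm wq qmax.
have [/existsP[x /existsP[x' inv]]|] :=
  boolP [exists x, [exists x', inversion (flag q) (flag w) x x']].
  have [q' [z [_ q'z wz eqq' lt_q']]] := inversion_swap wq inv; right.
  have [|||->//|] := IH q'; rewrite ?eqq' //; first exact: leq_trans lt_q' le_qm.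
    by apply: subset_trans wz _; case/covers_flagP: q'z => U _ ->; apply: subD1set.
  by move/ltn_trans; apply.
rewrite negb_exists => /forallP qmin; left.
apply: flag_inj; apply/eqP; rewrite eq_sym eqEcard pmax qmax leqnn andbT.
apply/subsetP=> U Uq; have [_ _ dq _] := flagP q.
have kU : #|U| %/ d <= n %/ d by rewrite leq_div2r // -[X in _ <= X]card_ord max_card.
have [V Vp] := card_flag_ge pmax kU; rewrite divnK ?dq // => eVU.
have [<-//|VU] := eqVneq V U.
have /subsetPn[x xU xV] : ~~ (U \subset V).
  by apply: contra VU => UV; rewrite eq_sym eqEcard UV eVU /=.
have /subsetPn[x' x'V x'U] : ~~ (V \subset U).
  by apply: contra VU => UV; rewrite eqEcard UV eVU /=.
have xUV : x \in U :\: V by rewrite inE xV.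
have x'VU : x' \in V :\: U by rewrite inE x'U.
case: (ltngtP x' x) => [ltx|ltx|/val_inj ex]; last by rewrite ex xU in x'U.
  have := qmin x; rewrite negb_exists => /forallP/(_ x').
  by rewrite (inversion_of_cross wp Uq Vp).
by have := pmin x' x; rewrite (inversion_of_cross wq Vp Uq).
Qed.

Definition atom_weight a : nat := if a is Some s then weight (flag s) else 0.

Definition atom_order : seq (Omega d n) :=
  sort (fun a b => atom_weight a <= atom_weight b)
    (enum [pred a | covers (None : Omega d n) a]).

Lemma mem_atom_order a : (a \in atom_order) = covers (None : Omega d n) a.
Proof. by rewrite mem_sort mem_enum. Qed.

Lemma atom_order_le i k : i < k < size atom_order ->
  atom_weight (nth None atom_order i) <= atom_weight (nth None atom_order k).
Proof.
case/andP=> ik ks; have tr : transitive (fun a b => atom_weight a <= atom_weight b).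
  by move=> a b c; apply: leq_trans.
apply: (sorted_ltn_nth tr) => //; last exact: ltn_trans ks.
by apply: sort_sorted => a b; apply: leq_total.
Qed.

Lemma rao_bot : recursive_atom_ordering (None : Omega d n) atom_order.
Proof.
split; first by rewrite sort_uniq enum_uniq.
- exact: mem_atom_order.
- move=> j js late; have := mem_nth (Order.bottom : Omega d n) js; rewrite mem_atom_order.
  set a := nth _ _ j; case: a => [s _|]; last by move/covers_lt; rewrite ltxx.
  have [us ms] := covers_arrange s (Some s) late.
  exists [seq b <- enum [pred b | covers (Some s : Omega d n) b] | late b].
  exists [seq b <- enum [pred b | covers (Some s : Omega d n) b] | ~~ late b].
  split; first exact: rao_Some.
    exact: filter_all.
  by rewrite -all_predC; apply: filter_all.
move=> i k y ik; have [ik' ks] := andP ik; have is_ := ltn_trans ik' ks.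
have := atom_order_le ik.
have := mem_nth (None : Omega d n) is_; have := mem_nth (None : Omega d n) ks.
have : nth None atom_order i != nth None atom_order k.
  by rewrite nth_uniq ?ltn_eqF // sort_uniq enum_uniq.
rewrite !mem_atom_order.
case eq : (nth None atom_order i) => [q|]; last by move=> _ _ /covers_lt; rewrite ltxx.
case ep : (nth None atom_order k) => [p|]; last by move=> _ /covers_lt; rewrite ltxx.
rewrite !covers_bot // => qp /eqP pmax /eqP qmax le_qp.
case: y => [w|] //; rewrite !Omega_ltE => /proper_sub wq /proper_sub wp.
have [/existsP[x /existsP[x' inv]]|] :=
  boolP [exists x, [exists x', inversion (flag p) (flag w) x x']]; last first.
  (* Without inversions, [p] would be [q] or lighter than [q], against the ordering of the atoms. *)
  rewrite negb_exists => /forallP pmin; have [|e|] := inversion_free_min wp wq pmax qmax.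
  - by move=> x x'; have := pmin x; rewrite negb_exists => /forallP.
  - by rewrite e eqxx in qp.
  - by rewrite ltnNge [weight _ <= _]le_qp.
have [p' [z [pz p'z wz ep' ltp]]] := inversion_swap wp inv.
have : (Some p' : Omega d n) \in atom_order by rewrite mem_atom_order covers_bot // ep' pmax.
case/(nthP None)=> j js ej; exists j, (Some z); rewrite [nth _ _ j]ej.
split=> //; last by rewrite Omega_leE.
(* Since [p'] is strictly lighter than [p], its position cannot be [k] or later. *)
rewrite ltnNge; apply/negP; rewrite leq_eqVlt => /orP[/eqP kj|kj].
  by move: ej ltp; rewrite -kj ep => -[->]; rewrite ltnn.
have := @atom_order_le k j; rewrite kj js ej ep => /(_ isT) /=.
by rewrite leqNgt ltp.
Qed.

(** Atoms have full flags and get rank 1, and each merge removes one member. Flags have at most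
    [(n %/ d).+1] members, so the subtraction never truncates. *)
Definition Omega_rank a : nat := if a is Some s then (n %/ d).+2 - #|flag s| else 0.

Lemma Omega_rankS a b : covers a b -> Omega_rank b = (Omega_rank a).+1.
Proof.
case: a => [s|] sb; last first.
  case: b sb => [t|/covers_lt]; last by rewrite ltxx.
  by rewrite covers_bot //= => /eqP->; rewrite subSnn.
have [t eb] := covers_Some sb; rewrite eb in sb *.
have /covers_flagP[U Us et] := sb.
have := card_flag_le s; rewrite /= et (cardsD1 U (flag s)) Us add1n => le_n.
by rewrite subSS subSn // ltnW.
Qed.

End OmegaRAO.

Theorem mainTheorem3 (d n : nat) (hd : 1 <= d) (hdn : d %| n) :
  [/\ admits_recursive_atom_ordering (Omega d n),
      CL_shellable (Omega d n)
    & Cohen_Macaulay (Omega d n)].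
Proof.
have rao : admits_recursive_atom_ordering (Omega d n).
  by exists (atom_order d n); exact: rao_bot.
split=> //; first exact: rao_CL_shellable.
exact: (rao_Cohen_Macaulay (Omega_rankS hd) rao).
Qed.
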